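(* Let $\{(x_k,y_k,\gamma_k)\}_{k\ge0}$ and $\{(\tilde x_k,\tilde\gamma_k)\}_{k\ge1}$ be sequences generated by the partially inexact proximal ADMM (described in the context). For $i\ge1$ put $(r_{i,x},r_{i,y},r_{i,\gamma})=(x_{i-1}-x_i,\ y_{i-1}-y_i,\ \gamma_{i-1}-\gamma_i)$, and for $k\ge1$ define the ergodic quantities $$(x_k^a,y_k^a,\gamma_k^a)=\frac1k\sum_{i=1}^k(x_i,y_i,\gamma_i),\quad (\tilde x_k^a,\tilde\gamma_k^a)=\frac1k\sum_{i=1}^k(\tilde x_i,\tilde\gamma_i),\quad (r_{k,x}^a,r_{k,y}^a,r_{k,\gamma}^a)=\frac1k\sum_{i=1}^k(r_{i,x},r_{i,y},r_{i,\gamma}),$$ $$\varepsilon_{k,x}^a=\frac1k\sum_{i=1}^k\left\langle \frac{1}{\beta}r_{i,x}+A^*\tilde\gamma_i,\ \tilde x_i-\tilde x_k^a\right\rangle,\qquad \varepsilon_{k,y}^a=\frac1k\sum_{i=1}^k\left\langle (H+\beta B^*B)r_{i,y}+B^*\tilde\gamma_i,\ y_i-y_k^a\right\rangle .$$ Then, for every $k\ge1$, $\varepsilon_{k,x}^a\ge0$, $\varepsilon_{k,y}^a\ge0$, and $$\frac1\beta r_{k,x}^a\in\partial_{\varepsilon_{k,x}^a}f(\tilde x_k^a)-A^*\tilde\gamma_k^a,\qquad (H+\beta B^*B)r_{k,y}^a\in\partial_{\varepsilon_{k,y}^a}g(y_k^a)-B^*\tilde\gamma_k^a,\qquad \frac1{\beta\theta}r_{k,\gamma}^a=A\tilde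 x_k^a+By_k^a-b.$$ Moreover, there exists $\sigma\in\,]0,1[$, namely a scalar $\sigma\in[\tau_2,1[$ depending only on $\tau_1,\tau_2,\theta$ such that the matrix $G_\sigma$ (defined in the context) is positive semidefinite, such that for every $k\ge1$ $$\left(\frac1\beta\|r_{k,x}^a\|^2+\|r_{k,y}^a\|^2_{(H+\beta B^*B)}+\frac1{\beta\theta}\|r_{k,\gamma}^a\|^2\right)^{1/2}\le\frac{2\sqrt{(1+\mu)d_0}}{k}$$ and $$\varepsilon_{k,x}^a+\varepsilon_{k,y}^a\le\frac{3(1+\mu)(3-2\sigma)d_0}{2(1-\sigma)k},$$ where $d_0$ and $\mu=\mu(\sigma)$ are as defined in the context.
   Context: Setting. $\mathcal X,\mathcal Y,\Gamma$ are finite-dimensional real inner product spaces (norm $\|\cdot\|$ induced by the inner product); $f:\mathcal X\to[-\infty,\infty]$ and $g:\mathcal Y\to[-\infty,\infty]$ are proper, closed, convex functions; $A:\mathcal X\to\Gamma$, $B:\mathcal Y\to\Gamma$ are linear operators with adjoints $A^*,B^*$; $b\in\Gamma$. The problem is $\min\{f(x)+g(y): Ax+By=b\}$. For a self-adjoint positive semidefinite linear operator $Q$, $\|v\|_Q=\langle Qv,v\rangle^{1/2}$. For $\varepsilon\ge0$, the $\varepsilon$-subdifferential of a proper closed convex $h$ at $v$ is $\partial_\varepsilon h(v)=\{u: h(\tilde v)\ge h(v)+\langle u,\tilde v-v\rangle-\varepsilon\ \ \forall\tilde v\}$, and $\partial h=\partial_0h$. Partially inexact proximal ADMM. Data: an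 initial point $(x_0,y_0,\gamma_0)\in\mathcal X\times\mathcal Y\times\Gamma$, a penalty parameter $\beta>0$, error tolerances $\tau_1,\tau_2\in[0,1[$, a self-adjoint positive semidefinite linear operator $H:\mathcal Y\to\mathcal Y$, and a stepsize $$\theta\in\left]0,\ \frac{1-2\tau_1+\sqrt{(1-2\tau_1)^2+4(1-\tau_1)}}{2(1-\tau_1)}\right[.$$ For each $k\ge1$: (Step 1) compute $(v_k,\tilde x_k)\in\mathcal X\times\mathcal X$ such that $$v_k\in\partial f(\tilde x_k)-A^*\tilde\gamma_k,\qquad \|\tilde x_k-x_{k-1}+\beta v_k\|^2\le\tau_1\|\tilde\gamma_k-\gamma_{k-1}\|^2+\tau_2\|\tilde x_k-x_{k-1}\|^2,$$ where $\tilde\gamma_k=\gamma_{k-1}-\beta(A\tilde x_k+By_{k-1}-b)$, and compute an optimal solution $y_k\in\mathcal Y$ of $$\min_{y\in\mathcal Y}\Big\{g(y)-\langle\gamma_{k-1},By\rangle+\frac\beta2\|A\tilde x_k+By-b\|^2+\frac12\|y-y_{k-1}\|_H^2\Big\};$$ (Step 2) set $x_k=x_{k-1}-\beta v_k$ and $\gamma_k=\gamma_{k-1}-\theta\beta(A\tilde x_k+By_k-b)$. Let $\mathcal Z=\mathcal X\times\mathcal Y\times\Gamma$, let $T:\mathcal Z\rightrightarrows\mathcal Z$ be $T(x,y,\gamma)=(\partial f(x)-A^*\gamma)\times(\partial g(y)-B^*\gamma)\times\{Ax+By-b\}$, and let $M:\mathcal Z\to\mathcal Z$ be $M(x,y,\gamma)=(x/\beta,\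 (H+\beta B^*B)y,\ \gamma/(\theta\beta))$. Standing assumption: $T^{-1}(0)=\{z\in\mathcal Z:0\in T(z)\}$ is nonempty. Define $$d_0=\inf\{\|(x-x_0,y-y_0,\gamma-\gamma_0)\|_M^2:(x,y,\gamma)\in T^{-1}(0)\}.$$ For $\sigma\in[0,1[$ define $$G_\sigma=\begin{bmatrix}\sigma-1+(\sigma-\tau_1)\theta & (1-\theta)[\sigma-1+(1-\tau_1)\theta]\\ (1-\theta)[\sigma-1+(1-\tau_1)\theta] & \sigma-1+(2-\theta-\tau_1)\theta\end{bmatrix},$$ $$\mu=\mu(\sigma)=\frac{4[\sigma-1+(1-\tau_1)\theta]}{\theta^{3/2}}\max\Big\{1,\frac{\theta}{2-\theta}\Big\}.$$ *)

(* Defs.v *)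
From HB Require Import structures.
From mathcomp Require Import all_boot all_order all_algebra.
From mathcomp Require Import all_classical all_reals all_analysis.

Set Implicit Arguments.
Unset Strict Implicit.
Unset Printing Implicit Defensive.

Import Order.TTheory GRing.Theory Num.Theory.

Local Open Scope classical_set_scope.
Local Open Scope ring_scope.

(* A finite-dimensional real inner product space is a [V : vectType R] together
   with an inner product [d : {dot V for idfun}]. *)

Definition dnorm (R : realType) (V : vectType R) (d : V -> V -> R) (v : V) : R :=
  Num.sqrt (d v v).

Definition qnorm (R : realType) (V : vectType R) (d : V -> V -> R)
    (Q : V -> V) (v : V) : R :=
  Num.sqrt (d (Q v) v).

Definition dot3 (R : realType) (X Y G : vectType R)
    (dX : X -> X -> R) (dY : Y -> Y -> R) (dG : G -> G -> R)
    (z w : X * Y * G) : R :=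
  dX z.1.1 w.1.1 + dY z.1.2 w.1.2 + dG z.2 w.2.

Definition is_adjoint (R : realType) (V W : vectType R)
    (dV : {dot V for idfun}) (dW : {dot W for idfun})
    (A : 'Hom(V, W)) (As : 'Hom(W, V)) : Prop :=
  forall v w, dW (A v) w = dV v (As w).

(* [adjointP] and [adjoint_unique] below show that this choice is the adjoint. *)
Definition adjoint (R : realType) (V W : vectType R)
    (dV : {dot V for idfun}) (dW : {dot W for idfun})
    (A : 'Hom(V, W)) : 'Hom(W, V) :=
  xget 0 [set As | is_adjoint dV dW A As].

Definition self_adjoint_psd (R : realType) (V : vectType R)
    (d : {dot V for idfun}) (Q : 'End(V)) : Prop :=
  is_adjoint d d Q Q /\ forall v, 0 <= d (Q v) v.

Definition psdmx (R : realType) (n : nat) (S : 'M[R]_n) : Prop :=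
  S^T = S /\ forall u : 'cV[R]_n, 0 <= (u^T *m S *m u) 0 0.

Definition dot_row (R : realType) (V W : vectType R) (dW : {dot W for idfun})
    (A : 'Hom(V, W)) (w : W) : 'rV[R]_(\dim {:V}) :=
  \row_i dW (A (vbasis {:V})`_i) w.

Lemma dot_row_is_linear (R : realType) (V W : vectType R)
    (dW : {dot W for idfun}) (A : 'Hom(V, W)) : linear (dot_row dW A).
Proof. by move=> a u v; apply/rowP => i; rewrite !mxE linearPr. Qed.

Section Adjoint.
Context (R : realType) (V W : vectType R).
Context (dV : {dot V for idfun}) (dW : {dot W for idfun}).

Lemma dot_eq0 (u : V) : (forall v, dV v u = 0) -> u = 0.
Proof.
move=> h; apply/eqP/negPn/negP => /(@neq0_dnorm_gt0 _ _ _ dV).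
by rewrite h ltxx.
Qed.

Lemma dot_basis_ext (u u' : V) :
  (forall i : 'I_(\dim {:V}), dV (vbasis {:V})`_i u = dV (vbasis {:V})`_i u') ->
  u = u'.
Proof.
move=> h; apply/eqP; rewrite -subr_eq0; apply/eqP/dot_eq0 => v.
rewrite (coord_vbasis (memvf v)) linear_sumlz big1 // => i _.
by rewrite linearZl_LR linearBr /= h subrr mulr0.
Qed.

Lemma adjointP (A : 'Hom(V, W)) : is_adjoint dV dW A (adjoint dV dW A).
Proof.
pose phiL := GRing.isLinear.Build _ _ _ _ _ (dot_row_is_linear dV \1%VF).
pose psiL := GRing.isLinear.Build _ _ _ _ _ (dot_row_is_linear dW A).
pose phi : {linear V -> 'rV[R]_(\dim {:V})} := HB.pack (dot_row dV \1%VF) phiL.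
pose psi : {linear W -> 'rV[R]_(\dim {:V})} := HB.pack (dot_row dW A) psiL.
have phi_surj w : linfun phi ((linfun phi)^-1%VF w) = w.
  have k0 : lker (linfun phi) == 0%VS.
    apply/lker0P => u u'; rewrite !lfunE => /rowP h.
    by apply: dot_basis_ext => i; have := h i; rewrite !mxE !id_lfunE.
  apply: limg_lfunVK; have -> : limg (linfun phi) = fullv.
    apply/eqP; rewrite eqEdim subvf /= limg_dim_eq ?dimvf //=.
      by rewrite {1}/dim /= mul1n.
    by rewrite (eqP k0) capv0.
  exact: memvf.
rewrite /adjoint; apply: (@xgetPex _ 0 [set As | is_adjoint dV dW A As]).
exists ((linfun phi)^-1 \o linfun psi)%VF => v w.
rewrite {1}(coord_vbasis (memvf v)) {2}(coord_vbasis (memvf v)).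
rewrite linear_sum !linear_sumlz; apply: eq_bigr => i _ /=.
rewrite linearZ !linearZl_LR /=; congr (_ * _).
rewrite comp_lfunE [linfun psi _]lfunE /=.
have /rowP/(_ i) := phi_surj (psi w).
by rewrite [linfun phi _]lfunE !mxE id_lfunE.
Qed.

Lemma adjoint_unique (A : 'Hom(V, W)) (As : 'Hom(W, V)) :
  is_adjoint dV dW A As -> As = adjoint dV dW A.
Proof.
move=> h; apply/lfunP => w; apply: dot_basis_ext => i.
by rewrite -h -adjointP.
Qed.

End Adjoint.

Section ConvexFunctions.
Context (R : realType) (V : vectType R) (d : {dot V for idfun}).
Implicit Types (h : V -> \bar R) (v : V).

Definition proper_fun h : Prop :=
  (forall v, h v != -oo%E) /\ (exists v, h v != +oo%E).

Definition epigraph h : set (V * R^o) := [set p | (h p.1 <= p.2%:E)%E].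

Definition convex_fun h : Prop := convex_set (epigraph h).

(* Lower semicontinuity for the topology of the norm [dnorm d]; a [vectType]
   carries no canonical topology. *)
Definition closed_fun h : Prop :=
  forall v (a : R), (a%:E < h v)%E ->
    exists2 e : R, 0 < e & forall w, dnorm d (w - v) < e -> (a%:E < h w)%E.

Definition eps_subdiff (e : R) h v : set V :=
  [set u | forall w, (h v + (d u (w - v))%:E - e%:E <= h w)%E].

Definition subdiff h v : set V := eps_subdiff 0 h v.

End ConvexFunctions.

Section ADMM.
Context (R : realType) (X Y G : vectType R).
Context (dX : {dot X for idfun}) (dY : {dot Y for idfun}) (dG : {dot G for idfun}).
Context (f : X -> \bar R) (g : Y -> \bar R) (A : 'Hom(X, G)) (B : 'Hom(Y, G)).
Context (b : G) (beta : R) (H : 'End(Y)).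

Local Notation "A ^*x" := (adjoint dX dG A) (at level 2, format "A ^*x").
Local Notation "B ^*y" := (adjoint dY dG B) (at level 2, format "B ^*y").

Definition opT (z : X * Y * G) : set (X * Y * G) :=
  let: (x, y, c) := z in
  [set u - A^*x c | u in subdiff dX f x]
    `*` [set u - B^*y c | u in subdiff dY g y]
    `*` [set A x + B y - b].

Definition solutions : set (X * Y * G) := [set z | opT z 0].

Definition opHB : 'End(Y) := H + beta *: (B^*y \o B)%VF.

Definition opM (theta : R) (z : X * Y * G) : X * Y * G :=
  let: (x, y, c) := z in (beta^-1 *: x, opHB y, (theta * beta)^-1 *: c).

Definition dist0 (theta : R) (z0 : X * Y * G) : R :=
  inf [set qnorm (dot3 dX dY dG) (opM theta) (z - z0) ^+ 2 | z in solutions].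

Definition y_objective (xt : X) (y' : Y) (c' : G) (y : Y) : \bar R :=
  (g y + (- dG c' (B y) + beta / 2 * dnorm dG (A xt + B y - b) ^+ 2
          + 1 / 2 * qnorm dY H (y - y') ^+ 2)%:E)%E.

(* One iteration, from [(x', y', c')] to [(x, y, c)]; [c], [ct] stand for
   $\gamma$, $\tilde\gamma$. *)
Definition admm_step (tau1 tau2 theta : R) (x' : X) (y' : Y) (c' : G)
    (v xt : X) (ct : G) (x : X) (y : Y) (c : G) : Prop :=
  [/\ ct = c' - beta *: (A xt + B y' - b),
      [set u - A^*x ct | u in subdiff dX f xt] v,
      dnorm dX (xt - x' + beta *: v) ^+ 2
        <= tau1 * dnorm dG (ct - c') ^+ 2 + tau2 * dnorm dX (xt - x') ^+ 2 &
      forall w, (y_objective xt y' c' y <= y_objective xt y' c' w)%E] /\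
  (x = x' - beta *: v /\ c = c' - (theta * beta) *: (A xt + B y - b)).

(* The values at index 0 of [v], [xt], [ct] play no role. *)
Definition admm_sequence (tau1 tau2 theta : R) (x : nat -> X) (y : nat -> Y)
    (c : nat -> G) (v xt : nat -> X) (ct : nat -> G) : Prop :=
  forall k, (1 <= k)%N ->
    admm_step tau1 tau2 theta (x k.-1) (y k.-1) (c k.-1)
      (v k) (xt k) (ct k) (x k) (y k) (c k).

End ADMM.

Definition theta_bound (R : realType) (tau1 : R) : R :=
  (1 - 2 * tau1 + Num.sqrt ((1 - 2 * tau1) ^+ 2 + 4 * (1 - tau1)))
    / (2 * (1 - tau1)).

Definition Gmx (R : realType) (tau1 theta sigma : R) : 'M[R]_(1 + 1) :=
  let q := (1 - theta) * (sigma - 1 + (1 - tau1) * theta) in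
  block_mx (sigma - 1 + (sigma - tau1) * theta)%:M q%:M
           q%:M (sigma - 1 + (2 - theta - tau1) * theta)%:M.

Definition mu (R : realType) (tau1 theta sigma : R) : R :=
  4 * (sigma - 1 + (1 - tau1) * theta) / (theta `^ (3 / 2))
    * Num.max 1 (theta / (2 - theta)).

Definition resid (R : realType) (V : vectType R) (u : nat -> V) (i : nat) : V :=
  u i.-1 - u i.

Definition ergodic (R : realType) (V : vectType R) (u : nat -> V) (k : nat) : V :=
  k%:R^-1 *: \sum_(1 <= i < k.+1) u i.

Definition ergodic_eps (R : realType) (V : vectType R) (d : {dot V for idfun})
    (p q : nat -> V) (k : nat) : R :=
  k%:R^-1 * \sum_(1 <= i < k.+1) d (p i) (q i - ergodic q k).

(* Main.v *)
(* Put z = (x, y, gamma), zt = (xt, y, gammat) and measure lengths with the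
   semi-inner product m(z, w) = <M z, w>. The iteration is a hybrid proximal
   extragradient method: M(z_{k-1} - z_k) lies in T(zt_k), and
     |z_k - zt_k|^2 + eta_k <= sigma |z_{k-1} - zt_k|^2 + eta_{k-1}
   for suitable eta_k >= 0. For k >= 2 this follows from the positive
   semidefiniteness of G_sigma once <B(y_k - y_{k-1}), gamma_k - gamma_{k-1}> is
   bounded below by monotonicity of the subdifferential of g at y_k and y_{k-1};
   for k = 1 it holds with eta_0 = mu |z_0 - z*|^2, z* being any solution.
   Summing the identity
     2 m(z_{i-1} - z_i, zt_i - w) = |z_{i-1} - w|^2 - |z_i - w|^2
                                    + |z_i - zt_i|^2 - |z_{i-1} - zt_i|^2
   at w = z* bounds the iterates, hence the residuals (z_0 - z_k)/k, and at the
   ergodic mean w of the zt_i it bounds the total epsilon. All bounds hold for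
   every solution z*, so the infimum d0 is taken only at the end. *)

From HB Require Import structures.
Require Import Defs.
From mathcomp Require Import all_boot all_order all_algebra.
From mathcomp Require Import all_classical all_reals all_analysis.
From mathcomp Require Import ring lra.

Set Implicit Arguments.
Unset Strict Implicit.
Unset Printing Implicit Defensive.

Import Order.TTheory GRing.Theory Num.Theory.

Local Open Scope classical_set_scope.
Local Open Scope ring_scope.

(** * Ergodic means and telescoping sums *)

Section Ergodic.
Context (R : realType) (V : vectType R).
Implicit Types (u : nat -> V) (k : nat).

Lemma scale_ergodic u k : (0 < k)%N ->
  k%:R *: ergodic u k = \sum_(1 <= i < k.+1) u i.
Proof.
by move=> k0; rewrite scalerA divff ?scale1r// pnatr_eq0 -lt0n.
Qed.

Lemma sum_ergodic_dev u k : (0 < k)%N ->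
  \sum_(1 <= i < k.+1) (u i - ergodic u k) = 0.
Proof.
move=> k0; rewrite sumrB -scale_ergodic// sumr_const_nat subSS subn0.
by rewrite scaler_nat subrr.
Qed.

Lemma sum_resid u k : \sum_(1 <= i < k.+1) resid u i = u 0%N - u k.
Proof.
rewrite /resid; elim: k => [|k IH]; first by rewrite big_geq// subrr.
by rewrite big_nat_recr//= IH addrA subrK.
Qed.

Lemma ergodicD u u' k :
  ergodic (fun i => u i + u' i) k = ergodic u k + ergodic u' k.
Proof. by rewrite /ergodic big_split scalerDr. Qed.

Lemma ergodicZ (a : R) u k : ergodic (fun i => a *: u i) k = a *: ergodic u k.
Proof. by rewrite /ergodic -scaler_sumr !scalerA mulrC. Qed.

Lemma ergodic_linear (W : vectType R) (L : 'Hom(V, W)) u k :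
  L (ergodic u k) = ergodic (fun i => L (u i)) k.
Proof. by rewrite /ergodic linearZ linear_sum. Qed.

End Ergodic.

(** * Symmetric bilinear forms and inner products *)

Section SymmetricForm.
Context (R : realType) (V : lmodType R) (m : {symmetric V}).
Implicit Types u v w : V.

Lemma symC u v : m u v = m v u.
Proof. by rewrite hermC expr0 mul1r. Qed.

Let symDl u v w : m (u + v) w = m u w + m v w. Proof. exact: linearDl. Qed.
Let symDr u v w : m w (u + v) = m w u + m w v. Proof. exact: linearDr. Qed.
Let symNl u w : m (- u) w = - m u w. Proof. exact: linearNl. Qed.
Let symNr u w : m w (- u) = - m w u. Proof. exact: linearNr. Qed.
Let symZl (a : R) u w : m (a *: u) w = a * m u w. Proof. exact: linearZl_LR. Qed.
Let symZr (a : R) u w : m w (a *: u) = a * m w u. Proof. exact: linearZr_LR. Qed.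

(* Restricted to [m]: the library's rules also expand the products of [R]. *)
Definition symE := (symDl, symDr, symNl, symNr, symZl, symZr).

End SymmetricForm.

Section DotForm.
Context (R : realType) (V : lmodType R) (d : {dot V for idfun}).

Lemma dotC u v : d u v = d v u. Proof. exact: (symC d). Qed.

Let dDl u v w : d (u + v) w = d u w + d v w. Proof. exact: linearDl. Qed.
Let dDr u v w : d w (u + v) = d w u + d w v. Proof. exact: linearDr. Qed.
Let dNl u w : d (- u) w = - d u w. Proof. exact: linearNl. Qed.
Let dNr u w : d w (- u) = - d w u. Proof. exact: linearNr. Qed.
Let dZl (a : R) u w : d (a *: u) w = a * d u w. Proof. exact: linearZl_LR. Qed.
Let dZr (a : R) u w : d w (a *: u) = a * d w u. Proof. exact: linearZr_LR. Qed.

Definition dotE := (dDl, dDr, dNl, dNr, dZl, dZr).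

Lemma dot_ge0 v : 0 <= d v v.
Proof.
have [->|/(neq0_dnorm_gt0 (s := d))/ltW//] := eqVneq v 0.
by rewrite linear0r.
Qed.

Lemma dot_sqnormBC u v : d (u - v) (u - v) = d (v - u) (v - u).
Proof. by rewrite -[in LHS]opprB dNl dNr opprK. Qed.

End DotForm.

(** * Inequalities for positive semidefinite forms *)

Section PsdForm.
Context (R : realType) (V : vectType R) (m : {symmetric V}).
Context (m_ge0 : forall u, 0 <= m u u).

Lemma sqnormBC u v : m (u - v) (u - v) = m (v - u) (v - u).
Proof. by rewrite -[in LHS]opprB hnormN. Qed.

Lemma four_point p q t w :
  2 * m (p - q) (t - w)
  = m (p - w) (p - w) - m (q - w) (q - w) + m (q - t) (q - t) - m (p - t) (p - t).
Proof.
rewrite !(symE m) (symC m t p) (symC m t q) (symC m w p) (symC m w q).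
ring.
Qed.

Lemma sqnormD_le2 u v : m (u + v) (u + v) <= 2 * (m u u + m v v).
Proof.
have := m_ge0 (u - v).
rewrite !(symE m) (symC m v u); lra.
Qed.

Lemma sqnormD_le3 u v w :
  m (u + v + w) (u + v + w) <= 3 * (m u u + m v v + m w w).
Proof.
have := m_ge0 (u - v); have := m_ge0 (u - w); have := m_ge0 (v - w).
rewrite !(symE m) (symC m v u) (symC m w u).
by rewrite (symC m w v); lra.
Qed.

(** Expand the square of [t *: u + v] and divide by [t]. *)
Lemma young u v (t : R) : 0 < t ->
  - (2 * m u v) <= t * m u u + t^-1 * m v v.
Proof.
move=> t0; have := m_ge0 (t *: u + v).
rewrite !(symE m) (symC m v u) => h.
have : 0 <= t^-1 * (t * (t * m u u) + t * m u v + (t * m u v + m v v)).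
  by apply: mulr_ge0; [rewrite invr_ge0 ltW | lra].
have -> : t^-1 * (t * (t * m u u) + t * m u v + (t * m u v + m v v))
    = t * m u u + 2 * m u v + t^-1 * m v v by field; rewrite gt_eqF.
lra.
Qed.

(** Variance decomposition about the mean: the cross terms vanish because deviations from the mean
    sum to zero, and the variance is dropped. *)
Lemma sqnorm_ergodic_le p (u : nat -> V) k : (0 < k)%N ->
  k%:R * m (p - ergodic u k) (p - ergodic u k)
  <= \sum_(1 <= i < k.+1) m (p - u i) (p - u i).
Proof.
move=> k0; move: (ergodic u k) (sum_ergodic_dev u k0) => w sum0.
have E i : m (p - u i) (p - u i)
    = m (p - w) (p - w) - 2 * m (p - w) (u i - w) + m (u i - w) (u i - w).
  rewrite !(symE m) (symC m (u i) p) (symC m w p) (symC m w (u i)).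
  by ring.
rewrite (eq_bigr _ (fun i _ => E i)) big_split sumrB /=.
rewrite sumr_const_nat subSS subn0 -mulr_sumr.
rewrite -linear_sumr /= sum0 linear0r mulr0 subr0 mulr_natl lerDl.
exact: sumr_ge0.
Qed.

End PsdForm.

(** [D] is the squared initial distance, [E] the sum of |z_{i-1} - zt_i|^2, [P] the squared distance
    from z_0 to the ergodic mean, [S] the sum of the pairings. In 3 - 2 sigma = 2 (1 - sigma) + 1
    the summand 1 pays for [E], the rest for the other terms. *)
Lemma hpe_eps_arith (R : realType) (k sigma mu D S E P : R) :
  0 < 1 - sigma -> 1 <= k -> 0 <= D -> 0 <= mu -> 0 <= E ->
  (1 - sigma) * E <= (1 + mu) * D -> 2 * S <= P + mu * D ->
  k * P <= 3 * (k * D + k * ((1 + mu) * D) + E) ->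
  k^-1 * S <= 3 * (1 + mu) * (3 - 2 * sigma) * D / (2 * (1 - sigma) * k).
Proof.
move=> s1 k1 D0 mu0 E0 hE hS hP.
have k0 : 0 < k by lra.
have muD : 0 <= mu * D by rewrite mulr_ge0.
rewrite -subr_ge0.
have -> : 3 * (1 + mu) * (3 - 2 * sigma) * D / (2 * (1 - sigma) * k) - k^-1 * S
  = (2 * (1 - sigma) * k)^-1
    * (3 * (1 + mu) * (3 - 2 * sigma) * D - (1 - sigma) * (2 * S)).
  by field; rewrite !gt_eqF.
apply: mulr_ge0; first by rewrite invr_ge0 !mulr_ge0// ltW.
rewrite subr_ge0 -(ler_pM2l k0).
have hE' : (1 - sigma) * E <= k * ((1 + mu) * D).
  by apply: (le_trans hE); rewrite ler_peMl//; lra.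
have h1 : k * (2 * S) <= 3 * (k * D + k * ((1 + mu) * D) + E) + k * (mu * D).
  by have := ler_wpM2l (ltW k0) hS; lra.
have := ler_wpM2l (ltW s1) h1.
have : 0 <= (1 - sigma) * (k * (mu * D)) by rewrite !mulr_ge0// ltW.
by lra.
Qed.

(** * The abstract hybrid proximal extragradient method *)

Section HybridProximalExtragradient.
Context (R : realType) (V : vectType R) (m : {symmetric V}).
Context (m_ge0 : forall u, 0 <= m u u).
Context (z zt : nat -> V) (zs : V) (eta : nat -> R) (sigma mu : R).
Context (sigma_lt1 : sigma < 1).
Context (mu_ge0 : 0 <= mu).
Context (eta_ge0 : forall i, 0 <= eta i).
Context (eta0 : eta 0%N = mu * m (z 0%N - zs) (z 0%N - zs)).
Context (relative_error : forall i, (0 < i)%N ->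
  m (z i - zt i) (z i - zt i) + eta i
  <= sigma * m (z i.-1 - zt i) (z i.-1 - zt i) + eta i.-1).
Context (monotone_at_sol : forall i, (0 < i)%N ->
  0 <= m (z i.-1 - z i) (zt i - zs)).

Let D0 := m (z 0%N - zs) (z 0%N - zs).

(** Each step adds [four_point] to the relative error: [eta] telescopes, and the share 1 - sigma of
    each |z_{i-1} - zt_i|^2 accumulates on the left. *)
Lemma hpe_descent w k :
  2 * \sum_(1 <= i < k.+1) m (z i.-1 - z i) (zt i - w)
  + m (z k - w) (z k - w) + eta k
  + (1 - sigma) * \sum_(1 <= i < k.+1) m (z i.-1 - zt i) (z i.-1 - zt i)
  <= m (z 0%N - w) (z 0%N - w) + eta 0%N.
Proof.
elim: k => [|k IH]; first by rewrite !big_geq// !mulr0 addr0 add0r.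
rewrite !(@big_nat_recr _ _ _ k.+1)//=.
have := four_point m (z k) (z k.+1) (zt k.+1) w.
by have := relative_error (ltn0Sn k) => /=; move: IH; nra.
Qed.

Lemma hpe_bound k :
  m (z k - zs) (z k - zs) + eta k
  + (1 - sigma) * \sum_(1 <= i < k.+1) m (z i.-1 - zt i) (z i.-1 - zt i)
  <= (1 + mu) * D0.
Proof.
have := hpe_descent zs k; rewrite eta0 -/D0.
have : 0 <= \sum_(1 <= i < k.+1) m (z i.-1 - z i) (zt i - zs).
  by rewrite big_nat_cond sumr_ge0// => i /andP[/andP[i0 _] _];
    apply: monotone_at_sol.
lra.
Qed.

Lemma hpe_iterate_bound k : m (z k - zs) (z k - zs) <= (1 + mu) * D0.
Proof.
have := hpe_bound k; have := eta_ge0 k.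
have : 0 <= (1 - sigma) * \sum_(1 <= i < k.+1) m (z i.-1 - zt i) (z i.-1 - zt i).
  by rewrite mulr_ge0 ?sumr_ge0// subr_ge0 ltW.
lra.
Qed.

Lemma hpe_residual_bound k :
  m (z 0%N - z k) (z 0%N - z k) <= 4 * ((1 + mu) * D0).
Proof.
have -> : z 0%N - z k = (z 0%N - zs) + (zs - z k) by rewrite addrA subrK.
apply: le_trans (sqnormD_le2 m_ge0 _ _) _.
have := hpe_iterate_bound k; rewrite (sqnormBC m zs) -/D0.
have : 0 <= mu * D0 by exact: mulr_ge0 mu_ge0 (m_ge0 _).
lra.
Qed.

Lemma hpe_eps_bound k : (0 < k)%N ->
  k%:R^-1 * \sum_(1 <= i < k.+1) m (z i.-1 - z i) (zt i - ergodic zt k)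
  <= 3 * (1 + mu) * (3 - 2 * sigma) * D0 / (2 * (1 - sigma) * k%:R).
Proof.
move=> k0; have := hpe_descent (ergodic zt k) k.
have := sqnorm_ergodic_le m_ge0 (z 0%N) zt k0; rewrite eta0 -/D0.
move: (ergodic zt k) => w hJ hD.
have s1 : 0 < 1 - sigma by rewrite subr_gt0.
have hE := hpe_bound k.
(* The path from z_0 to zt_i goes through [zs] and z_{i-1}; the legs cost [D0], the iterate bound
   and a summable error. *)
have hz : \sum_(1 <= i < k.+1) m (z 0%N - zt i) (z 0%N - zt i)
    <= 3 * (k%:R * D0 + k%:R * ((1 + mu) * D0)
            + \sum_(1 <= i < k.+1) m (z i.-1 - zt i) (z i.-1 - zt i)).
  have cst (c : R) : \sum_(1 <= i < k.+1) c = k%:R * c.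
    by rewrite sumr_const_nat subSS subn0 mulr_natl.
  rewrite -(cst D0) -cst -!big_split mulr_sumr /=.
  apply: ler_sum => i _.
  have -> : z 0%N - zt i = (z 0%N - zs) + (zs - z i.-1) + (z i.-1 - zt i).
    by rewrite !addrA !subrK.
  apply: le_trans (sqnormD_le3 m_ge0 _ _ _) _.
  rewrite (sqnormBC m zs) -/D0 ler_pM2l// lerD2r lerD2l.
  exact: hpe_iterate_bound.
have E0 : 0 <= \sum_(1 <= i < k.+1) m (z i.-1 - zt i) (z i.-1 - zt i).
  exact: sumr_ge0.
have k1 : 1 <= k%:R :> R by rewrite ler1n.
have D0_ge0 : 0 <= D0 by exact: m_ge0.
apply: (hpe_eps_arith s1 k1 D0_ge0 mu_ge0 E0 _ _ (le_trans hJ hz)).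
  by apply: le_trans hE; rewrite lerDr addr_ge0.
apply: le_trans hD; rewrite -!addrA lerDl addr_ge0 ?m_ge0//.
by rewrite addr_ge0 ?eta_ge0// mulr_ge0 ?E0// ltW.
Qed.

End HybridProximalExtragradient.

(** * Convex functions, subgradients and their averages *)

Section Subdifferential.
Context (R : realType) (V : vectType R) (d : {dot V for idfun}).
Implicit Types (h : V -> \bar R) (u v w : V).

(** An infinite value at [v] would force [h] to be infinite everywhere, against properness. *)
Lemma subdiff_fin_num h u v : proper_fun h -> subdiff d h v u ->
  h v \is a fin_num.
Proof.
move=> [hNy [w hw]] /(_ w); rewrite fin_numE hNy /=; apply: contraPN => /eqP ->.
by rewrite sube0 addye// leye_eq (negPf hw).
Qed.

Lemma subdiff_ineq h u v w s : proper_fun h -> subdiff d h v u ->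
  (h w <= s%:E)%E -> fine (h v) + d u (w - v) <= s.
Proof.
move=> hp hu hw; have := le_trans (hu w) hw.
by rewrite -{1}(fineK (subdiff_fin_num hp hu)) sube0 -EFinD lee_fin.
Qed.

Lemma subdiff_monotone h u v u' v' : proper_fun h ->
  subdiff d h v u -> subdiff d h v' u' -> 0 <= d (u - u') (v - v').
Proof.
move=> hp hu hu'.
have hv : (h v <= (fine (h v))%:E)%E by rewrite fineK// (subdiff_fin_num hp hu).
have hv' : (h v' <= (fine (h v'))%:E)%E.
  by rewrite fineK// (subdiff_fin_num hp hu').
have := subdiff_ineq hp hu hv'; have := subdiff_ineq hp hu' hv.
by rewrite !(dotE d); lra.
Qed.

Lemma convex_fun_le h (t : R) u v (r s : R) : convex_fun h -> 0 <= t <= 1 ->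
  (h u <= r%:E)%E -> (h v <= s%:E)%E ->
  (h (t *: u + (1 - t) *: v)%R <= (t * r + (1 - t) * s)%:E)%E.
Proof.
move=> hc /andP[t0 t1] hu hv.
pose T : {i01 R} := @Itv01 R t t0 t1.
have := hc (u, r) (v, s) T; rewrite !inE; exact.
Qed.

(** Jensen's inequality by induction: the next mean is a convex combination of the previous mean and
    the new point. Real upper bounds [r] keep extended arithmetic out. *)
Lemma convex_fun_ergodic h (u : nat -> V) (r : nat -> R) k : convex_fun h ->
  (0 < k)%N -> (forall i, (0 < i)%N -> (h (u i) <= (r i)%:E)%E) ->
  (h (ergodic u k) <= (k%:R^-1 * \sum_(1 <= i < k.+1) r i)%:E)%E.
Proof.
move=> hc k0 hr; case: k k0 => // k _; elim: k => [|k IH].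
  by rewrite /ergodic !big_nat1 invr1 scale1r mul1r hr.
set t : R := k.+1%:R / k.+2%:R.
have k1 : k.+1%:R != 0 :> R by rewrite pnatr_eq0.
have k2 : k.+2%:R != 0 :> R by rewrite pnatr_eq0.
have t01 : 0 <= t <= 1.
  by rewrite divr_ge0//= ler_pdivrMr ?ltr0n// mul1r ler_nat.
have h1t : 1 - t = k.+2%:R^-1.
  by rewrite -{1}(divff k2) /t -mulrBl -natrB// subSnn mul1r.
have := convex_fun_le hc t01 IH (hr k.+2 isT).
rewrite h1t /t /ergodic; congr (h _ <= _%:E)%E.
  rewrite (@big_nat_recr _ _ _ k.+2)//= scalerDr scalerA; congr (_ *: _ + _).
  by rewrite mulrAC divff// mul1r.
rewrite (@big_nat_recr _ _ _ k.+2)//= mulrDr mulrA; congr (_ * _ + _).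
by rewrite mulrAC divff// mul1r.
Qed.

Lemma ergodic_subdiff h (p q : nat -> V) k : proper_fun h -> convex_fun h ->
  (0 < k)%N -> (forall i, (0 < i)%N -> subdiff d h (q i) (p i)) ->
  0 <= ergodic_eps d p q k /\
  eps_subdiff d (ergodic_eps d p q k) h (ergodic q k) (ergodic p k).
Proof.
move=> hp hc k0 hpq.
have kR : 0 < k%:R :> R by rewrite ltr0n.
set r := k%:R^-1 * \sum_(1 <= i < k.+1) fine (h (q i)).
have hr : (h (ergodic q k) <= r%:E)%E.
  apply: convex_fun_ergodic => // i i0.
  by rewrite fineK// (subdiff_fin_num hp (hpq i i0)).
(* The average of the subgradient inequalities, kept with the mean value [r], which dominates [h] at
   the mean point. *)
have key w s : (h w <= s%:E)%E ->
    r + d (ergodic p k) (w - ergodic q k) - ergodic_eps d p q k <= s.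
  move=> hw.
  have : \sum_(1 <= i < k.+1) (fine (h (q i)) + d (p i) (w - q i))
      <= \sum_(1 <= i < k.+1) s.
    rewrite !big_nat; apply: ler_sum => i /andP[i0 _].
    exact: subdiff_ineq hp (hpq i i0) hw.
  rewrite sumr_const_nat subSS subn0 -mulr_natl -(ler_pM2l (_ : 0 < k%:R^-1)).
    rewrite mulKf ?gt_eqF//; apply: le_trans.
    have -> : d (ergodic p k) (w - ergodic q k)
        = k%:R^-1 * \sum_(1 <= i < k.+1) d (p i) (w - ergodic q k).
      by rewrite [in LHS]/ergodic linearZl_LR /= linear_sumlz.
    rewrite /r /ergodic_eps.
    rewrite -mulrDr -mulrBr ler_pM2l ?invr_gt0// -big_split -sumrB /=.
    apply: ler_sum => i _; rewrite !(dotE d); lra.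
  by rewrite invr_gt0.
split.
  (* Testing at the mean point itself gives r - eps <= h(mean) <= r, hence eps >= 0. *)
  have := key _ _ (_ : h (ergodic q k) <= (fine (h (ergodic q k)))%:E)%E.
  have hf : h (ergodic q k) \is a fin_num.
    by rewrite fin_numE (hp.1) /= lt_eqF// (le_lt_trans hr)// ltry.
  rewrite fineK// lexx subrr linear0r addr0 => /(_ isT).
  by move: hr; rewrite -{1}(fineK hf) lee_fin; lra.
move=> w; have hwNy := hp.1 w.
have := key w; case: (h w) hwNy => [s _|_ _|//]; last by rewrite leey.
move=> /(_ s (lexx _)) hs.
apply: (@le_trans _ _ (r%:E + (d (ergodic p k) (w - ergodic q k))%:E
                        - (ergodic_eps d p q k)%:E)%E).
  by rewrite leeD2r// leeD2r.
by rewrite -EFinD lee_fin.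
Qed.

(* If [y] minimises [h + phi] with [phi] quadratic, comparing [y] with
   [y + t (w - y)] and letting [t] tend to 0 gives [- grad phi y] in the
   subdifferential of [h]. *)
Lemma argmin_subdiff h (phi : V -> R) (q : V -> R) u y :
  proper_fun h -> convex_fun h ->
  (forall (t : R) v, phi (y + t *: v) = phi y - t * d u v + t ^+ 2 * q v) ->
  (forall w, (h y + (phi y)%:E <= h w + (phi w)%:E)%E) ->
  subdiff d h y u.
Proof.
move=> [hNy [w0 hw0]] hc hphi hmin w.
have hy : h y \is a fin_num.
  rewrite fin_numE hNy /=; apply: contraNN hw0 => /eqP hy.
  by have := hmin w0; rewrite hy addye// leye_eq; case: (h w0).
have hwNy := hNy w; rewrite -(fineK hy) sube0 -EFinD.
case hw: (h w) hwNy => [s| |] // _; last by rewrite leey.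
rewrite lee_fin -subr_ge0.
have ineq t : 0 < t <= 1 -> 0 <= s - (fine (h y) + d u (w - y)) + t * q (w - y).
  move=> /andP[t0 t1].
  have h1 : (h w <= s%:E)%E by rewrite hw.
  have h2 : (h y <= (fine (h y))%:E)%E by rewrite fineK.
  have t01 : 0 <= t <= 1 by rewrite ltW.
  have := convex_fun_le hc t01 h1 h2.
  have -> : t *: w + (1 - t) *: y = y + t *: (w - y).
    by rewrite scalerBl scale1r scalerBr addrCA.
  move=> h3; have := hmin (y + t *: (w - y)); rewrite -{1}(fineK hy) hphi => h4.
  have := le_trans h4 (leeD2r _ h3).
  rewrite -!EFinD lee_fin => h5.
  rewrite -(pmulr_rge0 _ t0); nra.
have [q0|q0] := leP (q (w - y)) 0.
  by have := ineq 1; rewrite ltr01 lexx => /(_ isT); lra.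
rewrite leNgt; apply/negP => neg.
set a := s - _ in neg ineq.
(* For this [t] the quadratic term is at most [- a / 2], too small to offset the negative [a]. *)
have t1 : 0 < Num.min 1 (- a / (2 * q (w - y))) <= 1.
  by rewrite lt_min ltr01 divr_gt0 ?oppr_gt0 ?mulr_gt0//= ge_min lexx.
have := ineq _ t1; apply/negP; rewrite -ltNge.
have : Num.min 1 (- a / (2 * q (w - y))) * q (w - y) <= - a / 2.
  rewrite (_ : - a / 2 = - a / (2 * q (w - y)) * q (w - y)); last first.
    by field; rewrite gt_eqF.
  by rewrite ler_pM2r// ge_min lexx orbT.
lra.
Qed.

End Subdifferential.

(** * Scalar conditions on the stepsize and the choice of sigma *)

Section StepsizeAndSigma.
Context (R : realType).
Implicit Types (tau theta sigma : R).

(** [theta_bound] is the positive root of this quadratic: 4 (1 - tau) times the quadratic factors as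
    a difference of squares with both factors positive. *)
Lemma theta_boundP tau theta : 0 <= tau < 1 -> 0 < theta < theta_bound tau ->
  0 < 1 + (1 - 2 * tau) * theta - (1 - tau) * theta ^+ 2.
Proof.
move=> /andP[tau0 tau1] /andP[theta0]; rewrite /theta_bound.
set D := _ ^+ 2 + _; set S := Num.sqrt D => thetaS.
have q0 : 0 < 1 - tau by rewrite subr_gt0.
have D0 : 0 <= D by rewrite addr_ge0 ?sqr_ge0// mulr_ge0// ltW.
have S0 : 0 <= S by exact: sqrtr_ge0.
have SS : S ^+ 2 = D by exact: sqr_sqrtr.
have pS : `|1 - 2 * tau| <= S.
  by rewrite -sqrtr_sqr ler_sqrt// lerDl mulr_ge0// ltW.
have : theta * (2 * (1 - tau)) < 1 - 2 * tau + S.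
  by rewrite -ltr_pdivlMr// mulr_gt0.
move: pS; rewrite ler_norml => /andP[pS1 pS2] up.
have lo : - S < theta * (2 * (1 - tau)) - (1 - 2 * tau).
  by have : 0 < theta * (2 * (1 - tau)) by [rewrite !mulr_gt0]; lra.
have : 0 < (S - (theta * (2 * (1 - tau)) - (1 - 2 * tau)))
           * (S + (theta * (2 * (1 - tau)) - (1 - 2 * tau))).
  by rewrite mulr_gt0//; lra.
have -> : (S - (theta * (2 * (1 - tau)) - (1 - 2 * tau)))
          * (S + (theta * (2 * (1 - tau)) - (1 - 2 * tau)))
  = S ^+ 2 - (theta * (2 * (1 - tau)) - (1 - 2 * tau)) ^+ 2 by ring.
rewrite SS /D => h.
rewrite -(pmulr_rgt0 _ q0); lra.
Qed.

(** The quadratic of [theta_boundP] equals -1 - (theta - 2) ((1 - tau) theta + 1), which is negative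
    once theta >= 2. *)
Lemma theta_lt2 tau theta : 0 <= tau < 1 -> 0 < theta < theta_bound tau ->
  theta < 2.
Proof.
move=> htau htheta; have := theta_boundP htau htheta.
case/andP: htau => tau0 tau1; rewrite !ltNge; apply: contraNN => theta2.
have : 0 <= (theta - 2) * ((1 - tau) * theta + 1) by rewrite mulr_ge0//; nra.
nra.
Qed.

(** For t <= 1 the loss is at most (|p1| + |p2|) t, which the chosen [e] keeps below p0. *)
Lemma quadratic_pos_near0 (p0 p1 p2 : R) : 0 < p0 ->
  exists2 e : R, 0 < e &
    forall t, 0 <= t <= e -> 0 < p0 + p1 * t + p2 * t ^+ 2.
Proof.
move=> p0_gt0; set a : R := `|p1| + `|p2| + 1.
have a0 : 0 < a by rewrite /a ltr_wpDl// addr_ge0.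
exists (Num.min 1 (p0 / (2 * a))).
  by rewrite lt_min ltr01 divr_gt0// mulr_gt0.
move=> t /andP[t0]; rewrite le_min => /andP[t1].
rewrite ler_pdivlMr ?mulr_gt0// => ta.
have h1 : - (`|p1| * t) <= p1 * t.
  by rewrite -mulNr ler_wpM2r// lerNl -normrN ler_norm.
have h2 : - (`|p2| * t) <= p2 * t ^+ 2.
  have : - (`|p2| * t ^+ 2) <= p2 * t ^+ 2.
    by rewrite -mulNr ler_wpM2r ?sqr_ge0// lerNl -normrN ler_norm.
  apply: le_trans; rewrite lerN2 ler_wpM2l// expr2 ler_piMr//.
move: ta; rewrite /a; lra.
Qed.

(* [corner] and [corner'] are the diagonal entries of [Gmx], and [(1 - theta)]
   times [slope] is the off-diagonal one. *)
Definition corner tau theta sigma : R := sigma - 1 + (sigma - tau) * theta.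
Definition slope tau theta sigma : R := sigma - 1 + (1 - tau) * theta.
Definition corner' tau theta sigma : R := sigma - 1 + (2 - theta - tau) * theta.
Definition det tau theta sigma : R :=
  corner tau theta sigma * corner' tau theta sigma
  - ((1 - theta) * slope tau theta sigma) ^+ 2.

(* For [theta > 1] the first iteration may increase the distance to a solution;
   this is what the factor [theta / (2 - theta)] of [mu] then has to dominate.
   At [sigma = 1] it reads [theta < sqrt theta / (2 - theta)], strictly. *)
Definition first_step_condition tau theta sigma : Prop := 1 < theta ->
  4 * theta * slope tau theta sigma ^+ 2
  + (1 - sigma) * ((theta - 1) * (1 + 4 * theta * (theta - 1)))
    * corner tau theta sigma
  <= 4 * slope tau theta sigma * (Num.sqrt theta / (2 - theta))
     * corner tau theta sigma.

(** With r = sqrt theta the claim is r (2 - r^2) < 1, that is (r - 1) (r^2 + r - 1) > 0. *)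
Lemma sqrt_ratio_gt theta : 1 < theta < 2 ->
  theta < Num.sqrt theta / (2 - theta).
Proof.
move=> /andP[theta1 theta2].
have r1 : 1 < Num.sqrt theta.
  by rewrite -[ltLHS]sqrtr1 ltr_sqrt// (lt_trans _ theta1).
have rr : theta = Num.sqrt theta ^+ 2.
  by rewrite sqr_sqrtr// ltW// (lt_trans _ theta1).
rewrite ltr_pdivlMr ?subr_gt0//.
have -> : theta * (2 - theta)
    = Num.sqrt theta * (Num.sqrt theta * (2 - Num.sqrt theta ^+ 2)).
  by rewrite -rr mulrA -expr2 -rr.
rewrite gtr_pMr ?(lt_trans _ r1)//; set r := Num.sqrt theta in r1 *.
have : 0 < (r - 1) * (r ^+ 2 + r - 1) by rewrite mulr_gt0//; nra.
by lra.
Qed.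

(** With sigma = 1 - t, the conditions on [slope], [corner], [det] and the first step say that
    polynomials in t of degree at most 2 are positive or nonnegative. Their constant terms are
    positive, so a small t serves all of them. *)
Lemma exists_sigma tau tau2 theta :
  0 <= tau < 1 -> 0 <= tau2 < 1 -> 0 < theta < theta_bound tau ->
  exists sigma,
    [/\ 0 < sigma < 1, tau2 <= sigma, 0 < slope tau theta sigma,
        0 < corner tau theta sigma & 0 < det tau theta sigma] /\
    first_step_condition tau theta sigma.
Proof.
move=> htau /andP[tau20 tau21] htheta.
have hq := theta_boundP htau htheta; have theta2 := theta_lt2 htau htheta.
case/andP: htau => tau0 tau1; case/andP: htheta => theta0 _.
rewrite /first_step_condition; set w := (1 - tau) * theta; set w' := (2 - theta - tau) * theta.
set kap := Num.sqrt theta / (2 - theta).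
set K := (theta - 1) * (1 + 4 * theta * (theta - 1)).
have w0 : 0 < w by rewrite mulr_gt0// subr_gt0.
have [e1 e10 H1] := @quadratic_pos_near0 w (-1) 0 w0.
have [e2 e20 H2] := @quadratic_pos_near0 w (- (1 + theta)) 0 w0.
(* The determinant at sigma = 1; this is where the upper bound on theta enters. *)
have d0 : 0 < w * w' - (1 - theta) ^+ 2 * w ^+ 2.
  have -> : w * w' - (1 - theta) ^+ 2 * w ^+ 2
      = w * (theta * (1 + (1 - 2 * tau) * theta - (1 - tau) * theta ^+ 2)).
    by rewrite /w /w'; ring.
  exact: mulr_gt0 w0 (mulr_gt0 theta0 hq).
have [e3 e30 H3] := quadratic_pos_near0
  (- w - (1 + theta) * w' + 2 * (1 - theta) ^+ 2 * w)
  (1 + theta - (1 - theta) ^+ 2) d0.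
(* The polynomial is the difference of the two sides of [first_step_condition]; for theta <= 1 that
   condition is vacuous and any [e] works. *)
have [e4 e40 H4] : exists2 e : R, 0 < e & forall t, 0 <= t <= e -> 1 < theta ->
    0 < 4 * w ^+ 2 * (kap - theta)
        + (- (4 * kap * w * (2 + theta)) + 8 * theta * w - K * w) * t
        + (4 * kap * (1 + theta) - 4 * theta + K * (1 + theta)) * t ^+ 2.
  have [theta_le1|theta_gt1] := leP theta 1; first by exists 1.
  have k0 : 0 < 4 * w ^+ 2 * (kap - theta).
    apply: mulr_gt0; first by rewrite mulr_gt0// exprn_gt0.
    by rewrite subr_gt0; apply: sqrt_ratio_gt; rewrite theta_gt1.
  by have [e e0 H] := quadratic_pos_near0
    (- (4 * kap * w * (2 + theta)) + 8 * theta * w - K * w)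
    (4 * kap * (1 + theta) - 4 * theta + K * (1 + theta)) k0;
    exists e => // t /H.
(* The bound 1/2 keeps sigma positive, and 1 - tau2 keeps it at least tau2. *)
set t := Num.min (Num.min 2^-1 (1 - tau2))
  (Num.min (Num.min e1 e2) (Num.min e3 e4)).
have t0 : 0 < t by rewrite !lt_min e10 e20 e30 e40 subr_gt0 tau21 invr_gt0 ltr0n.
have /and5P[t12 tt2 te1 te2 /andP[te3 te4]] :
    [&& t <= 2^-1, t <= 1 - tau2, t <= e1, t <= e2 & (t <= e3) && (t <= e4)].
  by have := lexx t; rewrite {2}/t !le_min -!andbA.
move: (t) t0 t12 tt2 te1 te2 te3 te4 => {}t t0 t12 tt2 te1 te2 te3 te4.
have in_ e : t <= e -> 0 <= t <= e by move=> ->; rewrite ltW.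
have := H1 _ (in_ _ te1); have := H2 _ (in_ _ te2); have := H3 _ (in_ _ te3).
have := H4 _ (in_ _ te4).
rewrite /det /slope /corner /corner' => h4 h3 h2 h1.
exists (1 - t); split; [split|].
- by apply/andP; split; lra.
- lra.
- by move: h1; rewrite /w; lra.
- by move: h2; rewrite /w; lra.
- by move: h3; rewrite /w /w'; lra.
- by move=> /h4; rewrite /w; lra.
Qed.

(** Completing the square: [corner] times the quadratic form is a square plus [det] times a
    square. *)
Lemma psdmx_Gmx tau theta sigma :
  0 < corner tau theta sigma -> 0 < det tau theta sigma ->
  psdmx (Gmx tau theta sigma).
Proof.
rewrite /Gmx /det; set q : R := (1 - theta) * _.
rewrite -/(corner tau theta sigma) -/(corner' tau theta sigma).
move: (corner _ _ _) (corner' _ _ _) q => a c q a0 d0; split.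
  by rewrite tr_block_mx !tr_scalar_mx.
move=> u; rewrite -[u]vsubmxK [usubmx u]mx11_scalar [dsubmx u]mx11_scalar.
move: (usubmx u 0 0) (dsubmx u 0 0) => x y.
rewrite tr_col_mx !tr_scalar_mx mul_row_block mul_row_col -!scalar_mxM.
rewrite -!raddfD -!scalar_mxM -raddfD /= mxE eqxx mulr1n.
rewrite -(pmulr_rge0 _ a0).
have -> : a * ((x * a + y * q) * x + (x * q + y * c) * y)
    = (a * x + q * y) ^+ 2 + (a * c - q ^+ 2) * y ^+ 2 by ring.
by rewrite addr_ge0 ?sqr_ge0// mulr_ge0 ?sqr_ge0// ltW.
Qed.

Lemma theta_mul_mu tau theta sigma : 0 < theta < 2 ->
  theta * mu tau theta sigma
  = 4 * slope tau theta sigma / Num.sqrt theta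
    * Num.max 1 (theta / (2 - theta)).
Proof.
move=> /andP[theta0 theta2]; rewrite /mu -/(slope tau theta sigma).
have -> : theta `^ (3 / 2) = theta * Num.sqrt theta.
  rewrite -powR12_sqrt ?ltW// -{2}[theta]powRr1 ?ltW// -powRD.
    by congr (_ `^ _); field.
  by rewrite gt_eqF// implybT.
by field; rewrite sqrtr_eq0 -ltNge theta0 gt_eqF.
Qed.

Lemma mu_ge0 tau theta sigma : 0 < theta < 2 -> 0 < slope tau theta sigma ->
  0 <= mu tau theta sigma.
Proof.
move=> htheta s0; have := theta_mul_mu tau sigma htheta.
case/andP: htheta => theta0 _ h; rewrite -(pmulr_rge0 _ theta0) h.
by rewrite mulr_ge0 ?divr_ge0 ?mulr_ge0 ?sqrtr_ge0 ?le_max ?ler01// ltW.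
Qed.

(* [alpha], [rho], [omega], [h] are the quantities of the same name at the first
   iteration; [D0], [D1] are the squared distances of [z_0], [z_1] to a solution. *)
Lemma first_step_arith tau theta sigma (alpha rho omega h D0 D1 : R) :
  0 <= tau < 1 -> 0 < theta < 2 -> sigma < 1 ->
  0 < slope tau theta sigma -> 0 < corner tau theta sigma ->
  first_step_condition tau theta sigma ->
  0 <= alpha -> 0 <= omega -> 0 <= h -> 0 <= D0 -> 0 <= D1 ->
  0 <= alpha + 2 * rho + omega ->
  (forall t : R, 0 < t -> - (2 * rho) <= t * alpha + t^-1 * omega) ->
  (forall t : R, 0 < t ->
     h + alpha + theta * omega <= (1 + t) * D0 + (1 + t^-1) * D1) ->
  D1 + h + (1 - tau) * (alpha + 2 * rho + omega) + (1 - theta) * omega <= D0 ->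
  0 <= corner tau theta sigma * alpha + 2 * slope tau theta sigma * rho
       + (sigma * theta - slope tau theta sigma) * h
       + theta * (mu tau theta sigma * D0).
Proof.
move=> /andP[tau0 tau1] htheta sigma1 s0 g0 hsig al0 om0 h0 D00 D10 sum0.
move=> young hD dist.
rewrite mulrA theta_mul_mu//; case/andP: htheta => theta0 theta2.
have hs : sigma * theta - slope tau theta sigma
    = (1 - sigma) * (1 - theta) + tau * theta by rewrite /slope; ring.
rewrite hs; rewrite /first_step_condition in hsig.
move: (slope _ _ _) (corner _ _ _) s0 g0 hsig => s g s0 g0 hsig.
have r0 : 0 < Num.sqrt theta by rewrite sqrtr_gt0.
have rr : theta = Num.sqrt theta ^+ 2 by rewrite sqr_sqrtr// ltW.
have p1 : 0 <= (1 - tau) * (alpha + 2 * rho + omega).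
  by rewrite mulr_ge0// subr_ge0 ltW.
have [theta_le1|theta_gt1] := leP theta 1.
- have max1 : 4 * s / Num.sqrt theta * D0
      <= 4 * s / Num.sqrt theta * Num.max 1 (theta / (2 - theta)) * D0.
    rewrite ler_wpM2r// ler_peMr ?le_max ?lexx//.
    by rewrite divr_ge0 ?sqrtr_ge0// mulr_ge0// ltW.
  have p2 : 0 <= (1 - theta) * omega by rewrite mulr_ge0// subr_ge0.
  have p3 : 0 <= ((1 - sigma) * (1 - theta) + tau * theta) * h.
    by rewrite mulr_ge0// addr_ge0 ?mulr_ge0 ?subr_ge0// ltW.
  have hw : h + alpha + theta * omega <= 4 * D0.
    by have := hD 1 ltr01; rewrite invr1; lra.
  (* This Young weight yields a multiple of alpha + theta omega, which [hw] bounds by 4 D0; it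
     accounts for the factor 4 s / theta^(3/2) of mu. *)
  have hy : - (2 * s * rho) <= s / Num.sqrt theta * (alpha + theta * omega).
    have := young (Num.sqrt theta)^-1; rewrite invr_gt0 invrK => /(_ r0) hy.
    have := ler_wpM2l (ltW s0) hy.
    have -> : s / Num.sqrt theta * (alpha + theta * omega)
       = s * ((Num.sqrt theta)^-1 * alpha + Num.sqrt theta * omega).
      by rewrite {2}rr; field; rewrite gt_eqF.
    lra.
  have : s / Num.sqrt theta * (alpha + theta * omega)
      <= s / Num.sqrt theta * (4 * D0).
    by apply: ler_wpM2l; [rewrite divr_ge0// ltW | lra].
  have : 0 <= g * alpha by rewrite mulr_ge0// ltW.
  lra.
have max2 : Num.max 1 (theta / (2 - theta)) = theta / (2 - theta).
  by apply/max_idPr; rewrite ler_pdivlMr ?subr_gt0//; lra.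
rewrite max2.
have -> : 4 * s / Num.sqrt theta * (theta / (2 - theta)) * D0
    = 4 * s * (Num.sqrt theta / (2 - theta)) * D0.
  by rewrite {2}rr; field; rewrite !gt_eqF ?subr_gt0.
(* [hD] is used at the minimiser [2 * theta - 1] of its right-hand side when
   [sqrt D1 = (2 * theta - 1) * sqrt D0], the worst case. *)
have hom : omega <= 4 * theta * D0.
  have t0 : 0 < 2 * theta - 1 by lra.
  have h1 := hD _ t0.
  have h2 : theta * omega
      <= (2 * theta) * D0 + (1 + (2 * theta - 1)^-1) * (D0 + (theta - 1) * omega).
    have : (1 + (2 * theta - 1)^-1) * D1
        <= (1 + (2 * theta - 1)^-1) * (D0 + (theta - 1) * omega).
      rewrite ler_wpM2l//; first by rewrite addr_ge0// invr_ge0 ltW.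
      lra.
    lra.
  have h3 := ler_wpM2l (ltW t0) h2.
  have E : (2 * theta - 1)
      * (2 * theta * D0 + (1 + (2 * theta - 1)^-1) * (D0 + (theta - 1) * omega))
    = (2 * theta - 1) * (2 * theta * D0) + 2 * theta * (D0 + (theta - 1) * omega).
    by field; rewrite gt_eqF.
  rewrite E in h3; rewrite -(ler_pM2l theta0); lra.
have hh : h <= (1 + 4 * theta * (theta - 1)) * D0.
  have : (theta - 1) * omega <= (theta - 1) * (4 * theta * D0).
    by rewrite ler_wpM2l// subr_ge0 ltW.
  lra.
(* The weight g / s lets the available [g * alpha] absorb the alpha term exactly, so only omega
   remains to be bounded. *)
have hy : - (2 * s * rho) * g <= g ^+ 2 * alpha + s ^+ 2 * omega.
  have gs : 0 < g / s by rewrite divr_gt0.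
  have := ler_wpM2l (ltW (mulr_gt0 s0 g0)) (young _ gs).
  have -> : s * g * (g / s * alpha + (g / s)^-1 * omega)
      = g ^+ 2 * alpha + s ^+ 2 * omega.
    by field; rewrite !gt_eqF.
  lra.
rewrite -(pmulr_rge0 _ g0).
have h1 : s ^+ 2 * omega <= s ^+ 2 * (4 * theta * D0).
  by rewrite ler_wpM2l// sqr_ge0.
have c0 : 0 <= g * ((1 - sigma) * (theta - 1)).
  by rewrite mulr_ge0 ?mulr_ge0 ?subr_ge0 ?ltW.
have h2 := ler_wpM2l c0 hh.
have h3 := ler_wpM2r D00 (hsig theta_gt1).
have h4 : 0 <= g * (tau * theta * h) by rewrite !mulr_ge0// ltW.
lra.
Qed.

End StepsizeAndSigma.

(** * A single ADMM iteration and a pair of consecutive ones *)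

Section Admm.
Context (R : realType) (X Y G : vectType R).
Context (dX : {dot X for idfun}) (dY : {dot Y for idfun}) (dG : {dot G for idfun}).
Context (f : X -> \bar R) (g : Y -> \bar R) (A : 'Hom(X, G)) (B : 'Hom(Y, G)).
Context (b : G) (beta : R) (H : 'End(Y)) (tau1 tau2 theta : R).
Context (proper_f : proper_fun f) (convex_f : convex_fun f).
Context (proper_g : proper_fun g) (convex_g : convex_fun g).
Context (beta_gt0 : 0 < beta) (theta_gt0 : 0 < theta).
Context (H_psd : self_adjoint_psd dY H).

Local Notation As := (adjoint dX dG A).
Local Notation Bs := (adjoint dY dG B).
Local Notation Q := (opHB dY dG B beta H).

Lemma dnorm_sqr (V : vectType R) (d : {dot V for idfun}) (v : V) :
  dnorm d v ^+ 2 = d v v.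
Proof. by rewrite sqr_sqrtr// dot_ge0. Qed.

Lemma H_sym u v : dY (H u) v = dY (H v) u.
Proof. by rewrite H_psd.1 (dotC dY). Qed.

Lemma qnorm_H_sqr v : qnorm dY H v ^+ 2 = dY (H v) v.
Proof. by rewrite sqr_sqrtr// H_psd.2. Qed.

Lemma dot_opHB u v : dY (Q u) v = dY (H u) v + beta * dG (B u) (B v).
Proof.
rewrite /opHB add_lfunE scale_lfunE comp_lfunE !(dotE dY) (dotC dY (Bs _)).
by rewrite -(adjointP dY dG B) (dotC dG).
Qed.

Lemma opHB_ge0 v : 0 <= dY (Q v) v.
Proof.
by rewrite dot_opHB addr_ge0 ?H_psd.2// mulr_ge0 ?dot_ge0// ltW.
Qed.

Lemma dot_As c v : dX (As c) v = dG c (A v).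
Proof. by rewrite (dotC dX) -(adjointP dX dG A) (dotC dG). Qed.

Lemma dot_Bs c v : dY (Bs c) v = dG c (B v).
Proof. by rewrite (dotC dY) -(adjointP dY dG B) (dotC dG). Qed.

Definition Mfun (z w : X * Y * G) : R :=
  dot3 dX dY dG (opM dY dG B beta H theta z) w.

Lemma MfunE z w : Mfun z w
  = beta^-1 * dX z.1.1 w.1.1
    + (dY (H z.1.2) w.1.2 + beta * dG (B z.1.2) (B w.1.2))
    + (theta * beta)^-1 * dG z.2 w.2.
Proof.
case: z => [[zx zy] zc]; rewrite /Mfun /dot3 /= !(dotE dX) !(dotE dG).
by rewrite dot_opHB.
Qed.

Lemma Mfun_sym z w : Mfun z w = Mfun w z.
Proof.
by rewrite !MfunE H_sym (dotC dX) (dotC dG (B _)) (dotC dG z.2).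
Qed.

Lemma Mfun_linear w : linear_for *%R (Mfun^~ w).
Proof.
move=> a u v; rewrite !MfunE /= !linearP /= !(dotE dX) !(dotE dY) !(dotE dG).
by ring.
Qed.

(** Symmetry of [Mfun] rests on the hypothesis on [H], so the bundled form is built inside a proof;
    it gives access to the results on symmetric forms. *)
Lemma Mform_exists : exists m : {symmetric (X * Y * G)%type},
  forall z w, m z w = Mfun z w.
Proof.
have add u' : zmod_morphism (Mfun^~ u').
  exact: zmod_morphism_linear (Mfun_linear u').
have scale u' : scalable_for *%R (Mfun^~ u').
  exact: scalable_linear (Mfun_linear u').
have addr u : zmod_morphism (Mfun u).
  by move=> v w; rewrite Mfun_sym add !(Mfun_sym u).
have scaler u : scalable_for (idfun \; *%R) (Mfun u).
  by move=> a v; rewrite Mfun_sym scale (Mfun_sym u).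
pose bil := isBilinear.Build R _ _ R *%R (idfun \; *%R) Mfun add addr scale scaler.
have herm z w : Mfun z w = (-1) ^+ false * idfun (Mfun w z).
  by rewrite expr0 mul1r Mfun_sym.
pose her := isHermitianSesquilinear.Build R _ false idfun Mfun herm.
pose m : {symmetric (X * Y * G)%type} := HB.pack Mfun bil her.
by exists m.
Qed.

Lemma Mfun_ge0 z : 0 <= Mfun z z.
Proof.
rewrite MfunE !addr_ge0 ?H_psd.2// mulr_ge0 ?dot_ge0// ?invr_ge0 ltW//.
exact: mulr_gt0.
Qed.

Lemma qnorm_M_sqr z :
  qnorm (dot3 dX dY dG) (opM dY dG B beta H theta) z ^+ 2 = Mfun z z.
Proof. by rewrite sqr_sqrtr// Mfun_ge0. Qed.

(* [|a|^2], [<a, c>] and [|c|^2] for [a = sqrt beta B u] and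
   [c = w / (theta sqrt beta)]. *)
Definition alpha (u : Y) : R := beta * dG (B u) (B u).
Definition rho (u : Y) (w : G) : R := theta^-1 * dG (B u) w.
Definition omega (w : G) : R := (theta ^+ 2 * beta)^-1 * dG w w.
Definition hH (u : Y) : R := dY (H u) u.

Lemma alpha_ge0 u : 0 <= alpha u.
Proof. by rewrite mulr_ge0 ?dot_ge0// ltW. Qed.

Lemma omega_ge0 w : 0 <= omega w.
Proof. by rewrite mulr_ge0 ?dot_ge0// invr_ge0 mulr_ge0 ?sqr_ge0// ltW. Qed.

(** This is |s a + t c|^2 for the vectors a, c behind [alpha] and [omega]; scaling by sqrt beta
    avoids square roots. *)
Lemma square_ge0 (s t : R) u w :
  0 <= s ^+ 2 * alpha u + 2 * s * t * rho u w + t ^+ 2 * omega w.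
Proof.
have := dot_ge0 dG ((s * beta) *: B u + (t / theta) *: w).
rewrite !(dotE dG) (dotC dG w) => h.
have := mulr_ge0 (ltW (_ : 0 < beta^-1)) h; rewrite invr_gt0 => /(_ beta_gt0).
congr (0 <= _); rewrite /alpha /rho /omega; field.
by rewrite !gt_eqF.
Qed.

Lemma young_rho u w t : 0 < t -> - (2 * rho u w) <= t * alpha u + t^-1 * omega w.
Proof.
move=> t0; have := square_ge0 t 1 u w.
rewrite -(pmulr_rge0 _ (_ : 0 < t^-1)) ?invr_gt0// => h.
rewrite -subr_ge0; move: h; congr (0 <= _); field.
by rewrite gt_eqF.
Qed.

Lemma solutionP (xs : X) (ys : Y) (cs : G) :
  solutions dX dY dG f g A B b (xs, ys, cs) ->
  [/\ subdiff dX f xs (As cs), subdiff dY g ys (Bs cs) & b = A xs + B ys].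
Proof.
move=> [[/= [u hu /eqP hu0] [w hw /eqP hw0]] hb].
move: hu0 hw0; rewrite !subr_eq0 => /eqP <- /eqP <-; split=> //.
by apply/eqP; rewrite eq_sym -subr_eq0; apply/eqP.
Qed.

Section Step.
Context (x' : X) (y' : Y) (c' : G) (v xt : X) (ct : G) (x : X) (y : Y) (c : G).
Context (step : admm_step dX dY dG f g A B b beta H tau1 tau2 theta
                  x' y' c' v xt ct x y c).

(** The update of [x] makes [v] equal to (x' - x) / beta. *)
Lemma step_f : subdiff dX f xt (beta^-1 *: (x' - x) + As ct).
Proof.
case: step => [[_ [u hu huv] _ _] [-> _]].
by rewrite opprB addrCA subrr addr0 scalerA mulVf ?gt_eqF// scale1r -huv subrK.
Qed.

Lemma residual_shift :
  A xt + B y' - b = (A xt + B y - b) - B (y - y').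
Proof.
rewrite linearB opprB [RHS]addrAC; congr (_ - _).
by rewrite -addrA; congr (_ + _); rewrite addrCA subrr addr0.
Qed.

(** Optimality in the subproblem puts minus the gradient of its quadratic part in the
    subdifferential. Since [ct] uses the residual at y' instead of y, rewriting with [ct] turns [H]
    into [Q]. *)
Lemma step_g : subdiff dY g y (Q (y' - y) + Bs ct).
Proof.
case: step => [[hct _ _ hmin] _].
pose q w := beta / 2 * dG (B w) (B w) + 1 / 2 * dY (H w) w.
apply: (argmin_subdiff (q := q) proper_g convex_g _ hmin) => t w; rewrite /q.
rewrite !dnorm_sqr !qnorm_H_sqr.
have -> : y + t *: w - y' = (y - y') + t *: w by rewrite addrAC.
have -> : A xt + B (y + t *: w) - b = (A xt + B y - b) + t *: B w.
  by rewrite linearD linearZ /= [in LHS]addrA [LHS]addrAC.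
rewrite [dY (_ + Bs ct) w](dotE dY) dot_opHB dot_Bs hct.
rewrite residual_shift.
rewrite -(opprB y y') [H (- _)]linearN [B (- _)]linearN /=.
move: (A xt + B y - b) (y - y') => e p.
rewrite [B (_ + _)]linearD [H (_ + _)]linearD /=.
rewrite [B (_ *: _)]linearZ [H (_ *: _)]linearZ /=.
rewrite !(dotE dG) !(dotE dY) (H_sym w p) (dotC dG (B w) e).
by field.
Qed.

Lemma step_residual : (theta * beta)^-1 *: (c' - c) = A xt + B y - b.
Proof.
case: step => [_ [_ ->]].
rewrite opprB addrCA subrr addr0 scalerA mulVf ?scale1r//.
by rewrite gt_eqF// mulr_gt0.
Qed.

(** Eliminates [ct]: its increment is sqrt beta (a + c), so its squared norm over beta is alpha + 2
    rho + omega. *)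
Lemma step_ct : ct - c' = theta^-1 *: (c - c') + beta *: B (y - y').
Proof.
case: step => [[-> _ _ _] [_ ->]].
rewrite residual_shift ![c' - _ - c']addrAC subrr !sub0r scalerN scalerA.
by rewrite mulKf ?gt_eqF// scalerBr opprB addrC.
Qed.

(** Monotonicity of both subdifferentials; the skew terms from [A] and [B] cancel against the
    multiplier component. *)
Lemma step_monotone_at_sol xs ys cs :
  solutions dX dY dG f g A B b (xs, ys, cs) ->
  0 <= Mfun ((x', y', c') - (x, y, c)) ((xt, y, ct) - (xs, ys, cs)).
Proof.
move=> /solutionP[hf hg hb].
have := subdiff_monotone proper_f step_f hf.
have := subdiff_monotone proper_g step_g hg.
have := congr1 (dG^~ (ct - cs)) step_residual.
rewrite MfunE /= hb.
have -> : A xt + B y - (A xs + B ys) = A (xt - xs) + B (y - ys).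
  by rewrite !linearB addrACA opprD.
have -> : Q (y' - y) + Bs ct - Bs cs = Q (y' - y) + Bs (ct - cs).
  by rewrite [Bs (ct - cs)]linearB addrA.
have -> : beta^-1 *: (x' - x) + As ct - As cs
    = beta^-1 *: (x' - x) + As (ct - cs).
  by rewrite [As (ct - cs)]linearB addrA.
move: (xt - xs) (y - ys) (ct - cs) (x' - x) (y' - y) (c' - c) => u w e p q r.
rewrite !(dotE dG) [dY (_ + _) _](dotE dY) !(dotE dX) dot_As dot_Bs dot_opHB.
rewrite (dotC dG (A u)) (dotC dG (B w)); lra.
Qed.

Lemma step_x_error :
  beta^-1 * dX (x - xt) (x - xt)
  <= tau1 * (alpha (y - y') + 2 * rho (y - y') (c - c') + omega (c - c'))
     + tau2 * (beta^-1 * dX (x' - xt) (x' - xt)).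
Proof.
case: (step) => [[_ _ herr _] [hx _]]; move: herr; rewrite !dnorm_sqr.
have -> : xt - x' + beta *: v = xt - x by rewrite hx opprB addrA [LHS]addrAC.
rewrite (dot_sqnormBC dX xt) (dot_sqnormBC dX xt x') step_ct.
move: (y - y') (c - c') => p q; rewrite !(dotE dG) (dotC dG q) => h.
have := ler_wpM2l (ltW (_ : 0 < beta^-1)) h; rewrite invr_gt0 => /(_ beta_gt0).
move=> /le_trans; apply; rewrite le_eqVlt; apply/orP; left; apply/eqP.
by rewrite /alpha /rho /omega; field; rewrite !gt_eqF.
Qed.

Lemma step_after : Mfun ((x, y, c) - (xt, y, ct)) ((x, y, c) - (xt, y, ct))
  = beta^-1 * dX (x - xt) (x - xt)
    + theta^-1 * (alpha (y - y') + 2 * (1 - theta) * rho (y - y') (c - c')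
                  + (1 - theta) ^+ 2 * omega (c - c')).
Proof.
rewrite MfunE /= [y - y]subrr [H 0]linear0 [B 0]linear0 /= !linear0r !addr0.
have -> : c - ct = (1 - theta^-1) *: (c - c') - beta *: B (y - y').
  rewrite scalerBl scale1r -addrA -opprD -step_ct opprB addrA subrK.
  by [].
move: (y - y') (c - c') => p q.
rewrite !(dotE dG) (dotC dG q) /alpha /rho /omega.
by field; rewrite !gt_eqF.
Qed.

Lemma step_before :
  Mfun ((x', y', c') - (xt, y, ct)) ((x', y', c') - (xt, y, ct))
  = beta^-1 * dX (x' - xt) (x' - xt) + hH (y - y') + alpha (y - y')
    + theta^-1 * (alpha (y - y') + 2 * rho (y - y') (c - c') + omega (c - c')).
Proof.
rewrite MfunE /= -(opprB y y') -(opprB ct c') step_ct.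
move: (y - y') (c - c') => p q; rewrite [B (- p)]linearN [H (- p)]linearN /=.
rewrite !(dotE dY) !(dotE dG) (dotC dG q) /alpha /rho /omega /hH.
by field; rewrite !gt_eqF.
Qed.

Lemma step_diff : Mfun ((x', y', c') - (x, y, c)) ((x', y', c') - (x, y, c))
  = beta^-1 * dX (x' - x) (x' - x) + hH (y - y') + alpha (y - y')
    + theta * omega (c - c').
Proof.
rewrite MfunE /= -(opprB y y') -(opprB c c').
move: (y - y') (c - c') => p q; rewrite [B (- p)]linearN [H (- p)]linearN /=.
rewrite !(dotE dY) !(dotE dG).
by rewrite /alpha /omega /hH; field; rewrite !gt_eqF.
Qed.

(** The leftover form in alpha, rho, omega has the diagonal of G_sigma, but its off-diagonal entry
    lacks the factor 1 - theta. [step_consecutive] supplies that factor. *)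
Lemma step_error sigma : tau2 <= sigma ->
  Mfun ((x, y, c) - (xt, y, ct)) ((x, y, c) - (xt, y, ct))
  + (sigma * hH (y - y')
     + theta^-1 * (corner tau1 theta sigma * alpha (y - y')
                   + 2 * slope tau1 theta sigma * rho (y - y') (c - c')
                   + corner' tau1 theta sigma * omega (c - c')))
  <= sigma * Mfun ((x', y', c') - (xt, y, ct)) ((x', y', c') - (xt, y, ct)).
Proof.
move=> hsig; rewrite step_after step_before; have := step_x_error.
have : tau2 * (beta^-1 * dX (x' - xt) (x' - xt))
       <= sigma * (beta^-1 * dX (x' - xt) (x' - xt)).
  by rewrite ler_wpM2r// mulr_ge0 ?dot_ge0// invr_ge0 ltW.
move: (alpha _) (rho _ _) (omega _) (hH _) => al ro om h.
move: (beta^-1 * _) (beta^-1 * _) => p q.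
move=> h1 h2; rewrite -subr_ge0.
have -> : sigma * (q + h + al + theta^-1 * (al + 2 * ro + om))
  - (p + theta^-1 * (al + 2 * (1 - theta) * ro + (1 - theta) ^+ 2 * om)
     + (sigma * h + theta^-1 * (corner tau1 theta sigma * al
          + 2 * slope tau1 theta sigma * ro + corner' tau1 theta sigma * om)))
  = (tau1 * (al + 2 * ro + om) + tau2 * q - p) + (sigma * q - tau2 * q).
  by rewrite /corner /slope /corner'; field; rewrite gt_eqF.
by rewrite addr_ge0 ?subr_ge0.
Qed.

Lemma step_g_dot w :
  dY (Q (y' - y) + Bs ct) w
  = dG (c' + theta^-1 *: (c - c')) (B w) - dY (H (y - y')) w.
Proof.
rewrite (dotE dY) dot_opHB dot_Bs -(subrK c' ct) step_ct -(opprB y y').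
rewrite [B (- _)]linearN [H (- _)]linearN /=.
by move: (y - y') (c - c') => p q; rewrite !(dotE dY) !(dotE dG); ring.
Qed.

End Step.

(** Monotonicity of the subdifferential of g between y and y', with the mixed [H] term bounded by
    Young. It trades the current multiplier increment for the previous one. *)
Lemma step_consecutive x'' y'' c'' v' xt' ct' x' y' c' v xt ct x y c :
  admm_step dX dY dG f g A B b beta H tau1 tau2 theta
    x'' y'' c'' v' xt' ct' x' y' c' ->
  admm_step dX dY dG f g A B b beta H tau1 tau2 theta
    x' y' c' v xt ct x y c ->
  2 * (1 - theta) * rho (y - y') (c' - c'') + hH (y - y') - hH (y' - y'')
  <= 2 * rho (y - y') (c - c').
Proof.
move=> st' st; have := subdiff_monotone proper_g (step_g st) (step_g st').
have -> : dY (Q (y' - y) + Bs ct - (Q (y'' - y') + Bs ct')) (y - y')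
    = dY (Q (y' - y) + Bs ct) (y - y') - dY (Q (y'' - y') + Bs ct') (y - y').
  by rewrite linearBl.
rewrite (step_g_dot st) (step_g_dot st').
have -> : c' + theta^-1 *: (c - c') = c'' + (c' - c'') + theta^-1 *: (c - c').
  by rewrite [c'' + _]addrC subrK.
have := H_psd.2 ((y - y') - (y' - y'')).
rewrite /rho /hH; move: (y - y') (y' - y'') (c - c') (c' - c'') => u w p q.
rewrite [H (u - w)]linearB /= !(dotE dY) !(dotE dG) (H_sym w u).
rewrite (dotC dG c'') (dotC dG p) (dotC dG q).
have -> : 2 * (1 - theta) * (theta^-1 * dG (B u) q)
    = 2 * (theta^-1 * dG (B u) q) - 2 * dG (B u) q by field; rewrite gt_eqF.
lra.
Qed.

End Admm.

(** * The ADMM sequence as a hybrid proximal extragradient method *)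

Section Sequence.
Context (R : realType) (X Y G : vectType R).
Context (dX : {dot X for idfun}) (dY : {dot Y for idfun}) (dG : {dot G for idfun}).
Context (f : X -> \bar R) (g : Y -> \bar R) (A : 'Hom(X, G)) (B : 'Hom(Y, G)).
Context (b : G) (beta : R) (H : 'End(Y)) (tau1 tau2 theta sigma : R).
Context (x : nat -> X) (y : nat -> Y) (c : nat -> G).
Context (v xt : nat -> X) (ct : nat -> G).
Context (proper_f : proper_fun f) (convex_f : convex_fun f).
Context (proper_g : proper_fun g) (convex_g : convex_fun g).
Context (beta_gt0 : 0 < beta) (H_psd : self_adjoint_psd dY H).
Context (admm : admm_sequence dX dY dG f g A B b beta H tau1 tau2 theta
                  x y c v xt ct).
Context (htau1 : 0 <= tau1 < 1) (htau2 : 0 <= tau2 < 1).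
Context (htheta : 0 < theta < 2) (tau2_le : tau2 <= sigma) (sigma_lt1 : sigma < 1).
Context (slope_gt0 : 0 < slope tau1 theta sigma).
Context (corner_gt0 : 0 < corner tau1 theta sigma).
Context (det_gt0 : 0 < det tau1 theta sigma).
Context (first_cond : first_step_condition tau1 theta sigma).

Local Notation As := (adjoint dX dG A).
Local Notation Bs := (adjoint dY dG B).
Local Notation Q := (opHB dY dG B beta H).
Local Notation z := (fun i => (x i, y i, c i)).
Local Notation zt := (fun i => (xt i, y i, ct i)).
Local Notation M := (Mfun dX dY dG B beta H theta).
Local Notation mu := (mu tau1 theta sigma).

Let theta_gt0 : 0 < theta. Proof. by case/andP: htheta. Qed.

Lemma corner'_gt0 : 0 < corner' tau1 theta sigma.
Proof.
rewrite -(pmulr_rgt0 _ corner_gt0); apply: lt_le_trans det_gt0 _.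
by rewrite /det gerBl sqr_ge0.
Qed.

(** Positivity of G_sigma on vector-valued arguments, again by completing the square after
    multiplying by [corner]. *)
Lemma consecutive_psd (u : Y) (w : G) :
  0 <= corner tau1 theta sigma * alpha dG B beta u
       + 2 * ((1 - theta) * slope tau1 theta sigma) * rho dG B theta u w
       + corner' tau1 theta sigma * omega dG beta theta w.
Proof.
have h := square_ge0 dG B beta_gt0 theta_gt0 (corner tau1 theta sigma)
  ((1 - theta) * slope tau1 theta sigma) u w.
have h' := mulr_ge0 (ltW det_gt0) (omega_ge0 dG theta beta_gt0 w).
rewrite -(pmulr_rge0 _ corner_gt0); move: h h'; rewrite /det; lra.
Qed.

(* The value at 0 replaces the missing previous increments. *)
Let eta (D0 : R) (k : nat) : R := if k is k'.+1 then
  theta^-1 * (corner' tau1 theta sigma * omega dG beta theta (c k - c k')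
              + slope tau1 theta sigma * hH dY H (y k - y k'))
  else mu * D0.

Let mu_pos : 0 <= mu. Proof. exact: mu_ge0. Qed.

Section AtSolution.
Context (zs : X * Y * G) (zs_sol : solutions dX dY dG f g A B b zs).

Let D0 : R := M (z 0%N - zs) (z 0%N - zs).

Let M_ge0 u : 0 <= M u u. Proof. exact: Mfun_ge0. Qed.

Lemma eta_ge0 k : 0 <= eta D0 k.
Proof.
case: k => [|k] /=; first exact: mulr_ge0 mu_pos (M_ge0 _).
apply: mulr_ge0; first by rewrite invr_ge0 ltW.
apply: addr_ge0; last exact: mulr_ge0 (ltW slope_gt0) (H_psd.2 _).
exact: mulr_ge0 (ltW corner'_gt0) (omega_ge0 dG theta beta_gt0 _).
Qed.

Lemma seq_monotone i : (0 < i)%N -> 0 <= M (z i.-1 - z i) (zt i - zs).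
Proof.
move=> i0; move: zs zs_sol => [[xs ys] cs] sol.
exact: (step_monotone_at_sol proper_f proper_g convex_g beta_gt0 theta_gt0
  H_psd (admm i0) sol).
Qed.

Lemma seq_first_step (m : {symmetric (X * Y * G)%type}) :
  (forall u w, m u w = M u w) ->
  0 <= corner tau1 theta sigma * alpha dG B beta (y 1 - y 0)
       + 2 * slope tau1 theta sigma * rho dG B theta (y 1 - y 0) (c 1 - c 0)
       + (sigma * theta - slope tau1 theta sigma) * hH dY H (y 1 - y 0)
       + theta * (mu * D0).
Proof.
move=> mE; have m_ge0 u : 0 <= m u u by rewrite mE.
have st := admm (leqnn 1).
have diff := step_diff dX dY dG B H beta_gt0 theta_gt0
  (x 0) (y 0) (c 0) (x 1) (y 1) (c 1).
apply: (first_step_arith (omega := omega dG beta theta (c 1 - c 0))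
  (D1 := M (z 1 - zs) (z 1 - zs)) htau1 htheta sigma_lt1 slope_gt0
  corner_gt0 first_cond).
- exact: alpha_ge0.
- exact: omega_ge0.
- exact: H_psd.2.
- exact: M_ge0.
- exact: M_ge0.
- have := square_ge0 dG B beta_gt0 theta_gt0 1 1 (y 1 - y 0) (c 1 - c 0).
  by rewrite !expr1n !mulr1 !mul1r.
- by move=> t t0; apply: young_rho.
- move=> t t0.
  have h1 : 0 <= beta^-1 * dX (x 0 - x 1) (x 0 - x 1).
    by rewrite mulr_ge0 ?dot_ge0// invr_ge0 ltW.
  have h2 : M (z 0%N - z 1%N) (z 0%N - z 1%N)
      <= (1 + t) * D0 + (1 + t^-1) * M (z 1%N - zs) (z 1%N - zs).
    have := young m_ge0 (z 0 - zs) (z 1 - zs) t0.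
    have -> : z 0%N - z 1%N = (z 0%N - zs) - (z 1%N - zs).
      by rewrite opprB addrA subrK.
    rewrite -!mE; rewrite /D0 -!mE.
    move: (z 0%N - zs) (z 1%N - zs) => p q; rewrite !(symE m) (symC m q p); lra.
  move: h2; rewrite diff; move: h1; lra.
have := four_point m (z 0%N) (z 1%N) (zt 1%N) zs; rewrite !mE.
have := seq_monotone (leqnn 1); rewrite -/D0 /= => h1.
(* At sigma = 1 the squared distances to zt_1 cancel against [four_point], leaving a bound on the
   squared distance of z_1 to the solution. *)
have := step_error beta_gt0 theta_gt0 st (ltW (andP htau2).2).
rewrite /= (_ : theta^-1 * _ = (1 - tau1) * (alpha dG B beta (y 1 - y 0)
   + 2 * rho dG B theta (y 1 - y 0) (c 1 - c 0) + omega dG beta theta (c 1 - c 0))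
   + (1 - theta) * omega dG beta theta (c 1 - c 0)).
  by move: h1; rewrite !mul1r; lra.
by rewrite /corner /slope /corner'; field; rewrite gt_eqF.
Qed.

(** [S] collects the alpha and rho terms, [u] is the omega term, and [e] is the previous [eta]; both
    the first and the later iterations reduce to the first premise. *)
Let relative_error_arith (p q S u h e : R) :
  0 <= S + (sigma * theta - slope tau1 theta sigma) * h + theta * e ->
  p + (sigma * h + theta^-1 * (S + u)) <= q ->
  p + theta^-1 * (u + slope tau1 theta sigma * h) <= q + e.
Proof.
move: (slope _ _ _) => s h1 h2.
have : 0 <= theta^-1 * (S + (sigma * theta - s) * h + theta * e).
  by rewrite mulr_ge0// invr_ge0 ltW.
have -> : theta^-1 * (S + (sigma * theta - s) * h + theta * e)
    = theta^-1 * S + sigma * h - theta^-1 * (s * h) + e.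
  by field; rewrite gt_eqF.
move: h2; lra.
Qed.

Lemma seq_relative_error (m : {symmetric (X * Y * G)%type}) i :
  (forall u w, m u w = M u w) -> (0 < i)%N ->
  M (z i - zt i) (z i - zt i) + eta D0 i
  <= sigma * M (z i.-1 - zt i) (z i.-1 - zt i) + eta D0 i.-1.
Proof.
move=> mE i0; have err := step_error beta_gt0 theta_gt0 (admm i0) tau2_le.
case: i i0 err => // -[|i] _ /= err; apply: (relative_error_arith _ err).
  exact: seq_first_step mE.
(* Now theta times the previous [eta] is explicit. Adding [slope] times the consecutive-step bound
   to [consecutive_psd] cancels the [slope] multiples of both [hH] terms. *)
rewrite mulVKf ?gt_eqF//.
have := step_consecutive proper_g convex_g theta_gt0 H_psd
  (admm (ltn0Sn i)) (admm (ltn0Sn i.+1)).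
have := consecutive_psd (y i.+2 - y i.+1) (c i.+1 - c i) => /= psd cons.
have h0 : 0 <= hH dY H (y i.+2 - y i.+1) by exact: H_psd.2.
have sh : 0 <= sigma * theta * hH dY H (y i.+2 - y i.+1).
  apply: mulr_ge0 => //; apply: mulr_ge0 (ltW theta_gt0).
  by apply: le_trans tau2_le; case/andP: htau2.
have := ler_wpM2l (ltW slope_gt0) cons; move: psd sh; lra.
Qed.

Lemma residual_and_eps_bound k : (0 < k)%N ->
  M (z 0%N - z k) (z 0%N - z k) <= 4 * ((1 + mu) * D0) /\
  k%:R^-1 * \sum_(1 <= i < k.+1) M (z i.-1 - z i) (zt i - ergodic zt k)
  <= 3 * (1 + mu) * (3 - 2 * sigma) * D0 / (2 * (1 - sigma) * k%:R).
Proof.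
move=> k0; have [m mE] := Mform_exists dX dG B beta theta H_psd.
have m_ge0 u : 0 <= m u u by rewrite mE.
have eta0 : eta D0 0 = mu * m (z 0%N - zs) (z 0%N - zs) by rewrite mE.
have rel i : (0 < i)%N -> m (z i - zt i) (z i - zt i) + eta D0 i
    <= sigma * m (z i.-1 - zt i) (z i.-1 - zt i) + eta D0 i.-1.
  by move=> i0; rewrite !mE; exact: (seq_relative_error mE i0).
have mono i : (0 < i)%N -> 0 <= m (z i.-1 - z i) (zt i - zs).
  by move=> i0; rewrite mE; exact: seq_monotone.
have := hpe_residual_bound m_ge0 sigma_lt1 mu_pos eta_ge0 eta0 rel mono k.
have := hpe_eps_bound m_ge0 sigma_lt1 mu_pos eta_ge0 eta0 rel mono k0.
rewrite !mE -/D0 (eq_bigr _ (fun i _ => mE _ _)) => h1 h2; split.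
  exact: h2.
exact: h1.
Qed.

End AtSolution.

Lemma ergodic_pair k : ergodic zt k = (ergodic xt k, ergodic y k, ergodic ct k).
Proof.
have S : \sum_(1 <= i < k.+1) zt i
    = (\sum_(1 <= i < k.+1) xt i, \sum_(1 <= i < k.+1) y i,
       \sum_(1 <= i < k.+1) ct i).
  elim: k => [|k IH]; first by rewrite !big_geq.
  by rewrite !(@big_nat_recr _ _ _ k.+1)//= IH.
by rewrite /ergodic S.
Qed.

Lemma le_dist0 r : solutions dX dY dG f g A B b !=set0 ->
  (forall zs, solutions dX dY dG f g A B b zs ->
     r <= M (z 0%N - zs) (z 0%N - zs)) ->
  r <= dist0 dX dY dG f g A B b beta H theta (z 0%N).
Proof.
move=> [z1 hz1] hr; apply: lb_le_inf.
  exists (qnorm (dot3 dX dY dG) (opM dY dG B beta H theta) (z1 - z 0%N) ^+ 2).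
  by exists z1.
move=> _ [zs hzs <-]; rewrite qnorm_M_sqr//; apply: le_trans (hr _ hzs) _.
by have [m mE] := Mform_exists dX dG B beta theta H_psd; rewrite -!mE sqnormBC.
Qed.

(** Symmetry of the covariance: either side is the sum of the products minus k times the product of
    the means. *)
Lemma sum_dot_ergodic_dev (p q : nat -> G) k : (0 < k)%N ->
  \sum_(1 <= i < k.+1) dG (p i) (q i - ergodic q k)
  = \sum_(1 <= i < k.+1) dG (q i) (p i - ergodic p k).
Proof.
move=> k0.
have E (r s : nat -> G) : \sum_(1 <= i < k.+1) dG (r i) (s i - ergodic s k)
    = \sum_(1 <= i < k.+1) dG (r i) (s i)
      - k%:R^-1 * dG (\sum_(1 <= i < k.+1) r i) (\sum_(1 <= i < k.+1) s i).
  rewrite linear_sumlz mulr_sumr -sumrB; apply: eq_bigr => i _.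
  by rewrite !(dotE dG).
rewrite !E (dotC dG (\sum_(_ <= _ < _) p _)); congr (_ - _).
by apply: eq_bigr => i _; rewrite dotC.
Qed.

Let w i := (theta * beta)^-1 *: (c i.-1 - c i).

Lemma ergodic_residual k : (0 < k)%N ->
  ergodic w k = A (ergodic xt k) + B (ergodic y k) - b.
Proof.
move=> k0.
have -> : ergodic w k = ergodic (fun i => A (xt i) + B (y i) - b) k.
  rewrite /ergodic; congr (_ *: _); apply: eq_big_nat => i /andP[i0 _].
  exact: (step_residual beta_gt0 theta_gt0 (admm i0)).
rewrite !ergodic_linear /ergodic sumrB big_split /= sumr_const_nat subSS subn0.
by rewrite scalerBr scalerDr -[b *+ k]scaler_nat scalerA
  mulVf ?scale1r// pnatr_eq0 -lt0n.
Qed.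

(** The adjoint terms pair [ct] with deviations of the constraint residual from its mean. Covariance
    symmetry moves the deviation onto [ct], giving the multiplier component of M. *)
Lemma eps_sum k : (0 < k)%N ->
  ergodic_eps dX (fun i => beta^-1 *: resid x i + As (ct i)) xt k
  + ergodic_eps dY (fun i => Q (resid y i) + Bs (ct i)) y k
  = k%:R^-1 * \sum_(1 <= i < k.+1) M (z i.-1 - z i)
       (zt i - (ergodic xt k, ergodic y k, ergodic ct k)).
Proof.
move=> k0; rewrite -mulrDr; congr (_ * _).
have h : \sum_(1 <= i < k.+1)
      dG (ct i) (A (xt i - ergodic xt k) + B (y i - ergodic y k))
    = \sum_(1 <= i < k.+1) dG (w i) (ct i - ergodic ct k).
  rewrite -sum_dot_ergodic_dev//; apply: eq_big_nat => i /andP[i0 _].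
  rewrite ergodic_residual// /w (step_residual beta_gt0 theta_gt0 (admm i0)).
  congr (dG _ _); rewrite [A (_ - _)]linearB [B (_ - _)]linearB /= addrACA.
  by rewrite -opprD opprB addrA subrK.
rewrite -big_split /=.
transitivity (\sum_(1 <= i < k.+1)
   (beta^-1 * dX (resid x i) (xt i - ergodic xt k)
    + dY (Q (resid y i)) (y i - ergodic y k)
    + dG (ct i) (A (xt i - ergodic xt k) + B (y i - ergodic y k)))).
  apply: eq_bigr => i _; move: (xt i - _) (y i - _) => p q.
  by rewrite dotE [dY (_ + _) _]dotE dot_As dot_Bs !(dotE dX) !(dotE dG); ring.
rewrite big_split /= h -big_split; apply: eq_bigr => i _ /=.
by rewrite MfunE /w /resid dot_opHB [dG (_ *: _) _]linearZl_LR.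
Qed.

(** Residuals telescope, so their mean is (z_0 - z_k) / k. *)
Lemma ergodic_resid_norm k :
  beta^-1 * dnorm dX (ergodic (resid x) k) ^+ 2
  + qnorm dY Q (ergodic (resid y) k) ^+ 2
  + (beta * theta)^-1 * dnorm dG (ergodic (resid c) k) ^+ 2
  = k%:R^-1 ^+ 2 * M (z 0%N - z k) (z 0%N - z k).
Proof.
rewrite !dnorm_sqr [qnorm _ _ _ ^+ 2]sqr_sqrtr ?opHB_ge0// /ergodic !sum_resid.
rewrite MfunE /= [theta * beta]mulrC dot_opHB.
move: (x 0 - x k) (y 0 - y k) (c 0 - c k) => p q r.
rewrite [B (_ *: _)]linearZ [H (_ *: _)]linearZ /= !(dotE dX) !(dotE dY).
by rewrite !(dotE dG); ring.
Qed.

End Sequence.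

(** * Assembly of the inclusions and rates, with passage to the infimum over solutions *)

Theorem theorem3p8 (R : realType) (tau1 tau2 theta : R)
    (htau1 : 0 <= tau1 < 1) (htau2 : 0 <= tau2 < 1)
    (htheta : 0 < theta < theta_bound tau1) :
  exists sigma : R,
    [/\ 0 < sigma < 1, tau2 <= sigma < 1 & psdmx (Gmx tau1 theta sigma)] /\
    forall (X Y G : vectType R)
      (dX : {dot X for idfun}) (dY : {dot Y for idfun}) (dG : {dot G for idfun})
      (f : X -> \bar R) (g : Y -> \bar R)
      (A : 'Hom(X, G)) (B : 'Hom(Y, G)) (b : G) (beta : R) (H : 'End(Y))
      (x : nat -> X) (y : nat -> Y) (c : nat -> G)
      (v xt : nat -> X) (ct : nat -> G),
    proper_fun f -> closed_fun dX f -> convex_fun f ->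
    proper_fun g -> closed_fun dY g -> convex_fun g ->
    0 < beta -> self_adjoint_psd dY H ->
    solutions dX dY dG f g A B b !=set0 ->
    admm_sequence dX dY dG f g A B b beta H tau1 tau2 theta x y c v xt ct ->
    forall k : nat, (1 <= k)%N ->
    let As := adjoint dX dG A in
    let Bs := adjoint dY dG B in
    let Q := opHB dY dG B beta H in
    let rx := resid x in
    let ry := resid y in
    let rc := resid c in
    let ex := ergodic_eps dX (fun i => beta^-1 *: rx i + As (ct i)) xt k in
    let ey := ergodic_eps dY (fun i => Q (ry i) + Bs (ct i)) y k in
    let d0 := dist0 dX dY dG f g A B b beta H theta (x 0%N, y 0%N, c 0%N) in
    let m := mu tau1 theta sigma in
    [/\ 0 <= ex, 0 <= ey,
        [set u - As (ergodic ct k) | u in eps_subdiff dX ex f (ergodic xt k)]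
          (beta^-1 *: ergodic rx k),
        [set u - Bs (ergodic ct k) | u in eps_subdiff dY ey g (ergodic y k)]
          (Q (ergodic ry k)) &
        (beta * theta)^-1 *: ergodic rc k
          = A (ergodic xt k) + B (ergodic y k) - b] /\
    Num.sqrt (beta^-1 * dnorm dX (ergodic rx k) ^+ 2
              + qnorm dY Q (ergodic ry k) ^+ 2
              + (beta * theta)^-1 * dnorm dG (ergodic rc k) ^+ 2)
      <= 2 * Num.sqrt ((1 + m) * d0) / k%:R /\
    ex + ey <= 3 * (1 + m) * (3 - 2 * sigma) * d0 / (2 * (1 - sigma) * k%:R).
Proof.
have htheta2 : 0 < theta < 2.
  by case/andP: (htheta) => -> _; exact: theta_lt2 htau1 htheta.
have [sigma [[sigma01 tau2_le slope_gt0 corner_gt0 det_gt0] hfirst]] :=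
  exists_sigma htau1 htau2 htheta.
have [sigma0 sigma1] := andP sigma01.
exists sigma; split; first by split; rewrite ?tau2_le//; exact: psdmx_Gmx.
move=> X Y G dX dY dG f g A B b beta H x y c v xt ct pf _ cf pg _ cg beta0 psdH
  sol admm k k0 As Bs Q rx ry rc ex ey d0 m.
have theta0 : 0 < theta by case/andP: htheta2.
have kR : 0 < k%:R :> R by rewrite ltr0n.
have m0 : 0 <= m by exact: mu_ge0.
have [ex0 incl_x] := ergodic_subdiff pf cf k0
  (fun i i0 => step_f beta0 (admm i i0)).
have [ey0 incl_y] := ergodic_subdiff pg cg k0
  (fun i i0 => step_g pg cg psdH (admm i i0)).
have bound zs := residual_and_eps_bound pf pg cg beta0 psdH admm htau1 htau2
  htheta2 tau2_le sigma1 slope_gt0 corner_gt0 det_gt0 hfirst (zs := zs).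
split; [split|split].
- exact: ex0.
- exact: ey0.
- eexists; first exact: incl_x.
  by rewrite ergodicD ergodicZ -(ergodic_linear As ct) addrK.
- eexists; first exact: incl_y.
  by rewrite ergodicD -(ergodic_linear Q ry) -(ergodic_linear Bs ct) addrK.
- rewrite -(ergodic_residual beta0 admm htheta2 k0) -ergodicZ.
  by rewrite [beta * theta]mulrC.
- rewrite (ergodic_resid_norm dX dG B theta x y c beta0 psdH).
  set Mk := Mfun _ _ _ _ _ _ _ _ _.
  have Mk0 : 0 <= Mk by exact: Mfun_ge0.
  (* Dividing by the constant turns the bound into a lower bound for the squared distance to every
     solution, hence for [d0]. *)
  have d0_ge : Mk / (4 * (1 + m)) <= d0.
    apply: (le_dist0 (x := x) (y := y) (c := c) beta0 psdH htheta2 sol) => zs hzs.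
    rewrite ler_pdivrMr ?mulr_gt0 ?ltr_pwDl// mulrC -mulrA.
    exact: (bound zs hzs k k0).1.
  rewrite -[leRHS]ger0_norm ?divr_ge0 ?mulr_ge0 ?sqrtr_ge0// -sqrtr_sqr.
  apply: ler_wsqrtr.
  rewrite !exprMn sqr_sqrtr; last first.
    apply: mulr_ge0; first exact: addr_ge0.
    by apply: le_trans d0_ge; rewrite divr_ge0// mulr_ge0// addr_ge0.
  rewrite mulrC ler_pM2r ?exprn_gt0 ?invr_gt0//.
  move: d0_ge; rewrite ler_pdivrMr ?mulr_gt0 ?ltr_pwDl//; lra.
(* The positive coefficient of [d0] is isolated so that the epsilon bound can pass to the infimum in
   the same way. *)
have C0 : 0 < 3 * (1 + m) * (3 - 2 * sigma) / (2 * (1 - sigma) * k%:R).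
  by rewrite divr_gt0 ?mulr_gt0 ?subr_gt0 ?ltr_pwDl//; lra.
rewrite mulrAC -ler_pdivrMl//.
apply: (le_dist0 (x := x) (y := y) (c := c) beta0 psdH htheta2 sol) => zs hzs.
rewrite ler_pdivrMl// [leRHS]mulrAC.
rewrite (eps_sum beta0 admm htheta2 k0).
by have := (bound zs hzs k k0).2; rewrite ergodic_pair.
Qed.
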